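(* Let $K=(K_{j,k})_{j,k\in\mathbb{N}_0}$ be an interaction kernel satisfying $$0\le K_{j,k}=K_{k,j}\le C_q\,(j^{\mu}k^{\nu}+j^{\nu}k^{\mu})\qquad\text{for all } j,k\in\mathbb{N}_0,$$ with a constant $C_q>0$ and exponents $\mu,\nu\in[0,2]$, $\mu+\nu\le 3$. Let $f(0)=(f_j(0))_{j\ge0}\in Y_1^+$ have finite initial mass $\rho:=M_1(f(0))<\infty$. (a) If $\lambda:=\max\{\mu,\nu\}>1$ and $f(0)\in Y_\lambda^+$, then the EDG system with kernel $K$ and initial data $f(0)$ has a global mild solution $f=(f_j)_{j\ge0}$ such that $f(t)\in Y_\lambda^+$ for each $t\in[0,\infty)$. (b) If $\max\{\mu,\nu\}\le 1$, then the EDG system with kernel $K$ and initial data $f(0)$ has a global mild solution $f=(f_j)_{j\ge0}$ such that $f(t)\in Y_1^+$ for each $t\in[0,\infty)$.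
   Context: $\mathbb{N}=\{1,2,\dots\}$, $\mathbb{N}_0=\mathbb{N}\cup\{0\}$. For $r\ge0$, $Y_r$ is the space of real sequences $f=(f_j)_{j\ge0}$ with $\|f\|_r:=\sum_{j=0}^\infty j^r|f_j|<\infty$, and $Y_r^+=\{f\in Y_r: f_j\ge0\ \text{for all } j\in\mathbb{N}_0\}$. For $p>0$, $M_p(f)=\sum_{j=0}^\infty j^pf_j$. The exchange-driven growth (EDG) system with kernel $K$ is $$\dot f_j=f_{j+1}\sum_{k=0}^\infty K_{j+1,k}f_k-f_j\sum_{k=0}^\infty K_{j,k}f_k-f_j\sum_{k=1}^\infty K_{k,j}f_k+f_{j-1}\sum_{k=1}^\infty K_{k,j-1}f_k\quad(j\in\mathbb{N}),$$ $$\dot f_0=f_1\sum_{k=0}^\infty K_{1,k}f_k-f_0\sum_{k=1}^\infty K_{k,0}f_k,$$ with prescribed initial data $f_j(0)$, $j\in\mathbb{N}_0$. Mild solution: let $T\in(0,\infty]$ and $f(0)\in Y_r^+$. A mild solution of the EDG system on $[0,T)$ with initial data $f(0)$ is a function $f:[0,T)\to Y_r^+$ such that (1) for all $j\in\mathbb{N}_0$, $f_j:[0,T)\to[0,\infty)$ is continuous, and $\sup_{t\in[0,T)}\|f(t)\|_r<\infty$; (2) $\int_0^t\sum_{k=0}^\infty K_{j,k}f_k(s)\,ds<\infty$ for all $j\in\mathbb{N}_0$, $t\in[0,T)$; (3) the EDG equations hold in time-integrated form for all $j\in\mathbb{N}_0$, $t\in[0,T)$, i.e. $f_j(t)-f_j(0)$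 equals the integral over $[0,t]$ of the right-hand side of the $j$-th equation, each of its terms being integrated separately. A global mild solution is a mild solution on $[0,\infty)$, i.e. the case $T=\infty$. *)

(* Defs.v *)
From HB Require Import structures.
From mathcomp Require Import all_boot all_order all_algebra.
From mathcomp Require Import all_classical all_reals all_analysis.

Set Implicit Arguments.
Unset Strict Implicit.
Unset Printing Implicit Defensive.

Import Order.TTheory GRing.Theory Num.Theory.
Import numFieldNormedType.Exports.

Local Open Scope classical_set_scope.
Local Open Scope ring_scope.
Local Open Scope ereal_scope.

(* Powers of indices use [powR], so that 0 `^ 0 = 1 and 0 `^ r = 0 for r > 0.
   All the series are extended-real valued. *)

Definition normY (R : realType) (r : R) (f : nat -> R) : \bar R :=
  \sum_(0 <= j <oo) (j%:R `^ r * `|f j|)%:E.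

Definition Y (R : realType) (r : R) : set (nat -> R) :=
  [set f | normY r f < +oo].

Definition Yplus (R : realType) (r : R) : set (nat -> R) :=
  [set f | Y r f /\ forall j, (0 <= f j)%R].

Definition moment (R : realType) (p : R) (f : nat -> R) : \bar R :=
  \sum_(0 <= j <oo) (j%:R `^ p * f j)%:E.

(* The time interval [0, T), where T may be +oo. *)
Definition timedom (R : realType) (T : \bar R) : set R :=
  [set t | (0 <= t)%R /\ t%:E < T].

Definition out_rate (R : realType) (K : nat -> nat -> R) (f : nat -> R)
    (j : nat) : \bar R :=
  \sum_(0 <= k <oo) (K j k * f k)%:E.

(* Only clusters of size k >= 1 can export: the sum starts at k = 1. *)
Definition in_rate (R : realType) (K : nat -> nat -> R) (f : nat -> R)
    (j : nat) : \bar R :=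
  \sum_(1 <= k <oo) (K k j * f k)%:E.

Definition out_term (R : realType) (K : nat -> nat -> R) (f : R -> nat -> R)
    (t : R) (j : nat) : \bar R :=
  \int[lebesgue_measure]_(s in `[0%R, t]) ((f s j)%:E * out_rate K (f s) j).

Definition in_term (R : realType) (K : nat -> nat -> R) (f : R -> nat -> R)
    (t : R) (j : nat) : \bar R :=
  \int[lebesgue_measure]_(s in `[0%R, t]) ((f s j)%:E * in_rate K (f s) j).

(* Right-hand side of the j-th time-integrated equation, term by term. Under
   [mild_solution] every term is finite: no oo - oo occurs. *)
Definition edg_integrated_rhs (R : realType) (K : nat -> nat -> R)
    (f : R -> nat -> R) (t : R) (j : nat) : \bar R :=
  match j with
  | 0%N => out_term K f t 1 - in_term K f t 0
  | i.+1 => out_term K f t i.+2 - out_term K f t i.+1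
            - in_term K f t i.+1 + in_term K f t i
  end.

(* The solution is a total function of time, of which only the values on
   [0, T) matter. *)
Record mild_solution (R : realType) (K : nat -> nat -> R) (r : R) (T : \bar R)
    (f0 : nat -> R) (f : R -> nat -> R) : Prop := MildSolution {
  mild_horizon : 0 < T ;
  mild_initial : f 0%R = f0 ;
  mild_Yplus : forall t, timedom T t -> Yplus r (f t) ;
  mild_continuous : forall j, {within timedom T, continuous (fun t => f t j)} ;
  mild_bounded : ereal_sup [set normY r (f t) | t in timedom T] < +oo ;
  mild_integrable : forall j t, timedom T t ->
    \int[lebesgue_measure]_(s in `[0%R, t]) out_rate K (f s) j < +oo ;
  mild_equation : forall j t, timedom T t ->
    (f t j - f 0%R j)%:E = edg_integrated_rhs K f t j
}.

(* The regularity index is r = 1 (finite mass): higher moments need not stay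
   bounded uniformly on [0, +oo). *)
Definition global_mild_solution (R : realType) (K : nat -> nat -> R)
    (f0 : nat -> R) (f : R -> nat -> R) : Prop :=
  mild_solution K 1%R +oo f0 f.

(* Main.v *)
Require Import Defs.
From HB Require Import structures.
From mathcomp Require Import all_boot all_order all_algebra.
From mathcomp Require Import all_classical all_reals all_analysis.
From mathcomp Require Import ring lra.

Import Order.TTheory GRing.Theory Num.Theory.
Import numFieldNormedType.Exports.

Local Open Scope classical_set_scope.
Local Open Scope ring_scope.

(** Explicit Euler steps for the system truncated at size N conserve the number
    of clusters and the mass.  Testing with a weight phi and symmetrising the
    kernel leaves only the second difference of phi, so a convex phi gains at
    most sum K(j,k) f_j f_k phi''(j), the collisions with empty clusters being
    favourable.  Let lam = max(mu, nu, 1).  The weights with slopes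
    i^lam / (i + n) are equivalent to j^lam for n = 0 and to j^lam beyond n in
    general, and mu, nu <= lam <= 2 with mu + nu <= 3 closes a Gronwall
    inequality for them: n = 0 bounds the moment of order lam, and n -> oo
    makes its tail small, uniformly in N and in the step.  Limits along an
    ultrafilter on N then exist at all times at once.  Uniform tails make the
    fluxes equicontinuous and let them pass to the limit, and the limit of the
    Riemann sums of a flux has the limit flux as its derivative. *)

(** * Convex weights *)

(** The model case is K = j^2 k + j k^2 with phi = j^2: the gain is of the order of M_2 M_1, linear
    in M_2 because the mass is conserved, and mu + nu <= 3 keeps this balance for the other
    exponents. The obstacle is that K(j,k) may grow like k^lam. A bound on the moment of order lam
    then does not let the rates pass to a componentwise limit, while the datum need not have any
    moment of higher order, so tightness of that very moment has to be propagated in time. A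
    superlinear factor adapted to the datum, as in the criterion of de la Vallee-Poussin, is
    replaced by an explicit family of weights. Up to constants they are j^lam * j / (j + n),
    dominated by j^lam and tending to 0 for each j as n grows, so the weighted moment starts small
    by dominated convergence. It stays small because its Gronwall rate does not depend on n and the
    source term, if any, vanishes as n grows. *)

Lemma gt0_powRD {R : realType} (x r s : R) :
  0 < x -> x `^ (r + s) = x `^ r * x `^ s.
Proof. by move=> x0; rewrite powRD// (gt_eqF x0) implybT. Qed.

(** Divided by x^2, this bounds a monomial of the kernel times x^(lam - 2), the size of the second
    difference of x^lam, by terms linear in the power lam. The excess exponent on the smaller of x
    and y is moved to the larger one, where mu + nu <= 3 leaves room for it. *)
Lemma powR_monomial_le {R : realType} (mu nu lam x y : R) :
  1 <= lam -> mu <= 2 -> nu <= lam -> mu + nu <= 3 -> 1 <= x -> 1 <= y ->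
  x `^ mu * y `^ nu * x `^ lam <= x ^+ 2 * (x `^ lam * y + x * y `^ lam).
Proof.
move=> lam1 mu2 nulam munu x1 y1.
have x0 : 0 < x by lra. have y0 : 0 < y by lra.
have xlam0 := powR_ge0 x lam. have ylam0 := powR_ge0 y lam.
have E2 (z : R) : 0 < z -> z ^+ 2 = z `^ 2.
  by move=> z0; rewrite -powR_mulrn ?ltW.
have [yx|xy] := leP y x.
- apply: (@le_trans _ _ (x ^+ 2 * (x `^ lam * y))); last first.
    by rewrite ler_pM2l ?exprn_gt0// lerDl mulr_ge0 // ltW.
  have -> : x ^+ 2 * (x `^ lam * y) = x ^+ 2 * y * x `^ lam by ring.
  apply: ler_wpM2r => //; rewrite E2//.
  have [nu1|nu1] := leP nu 1.
    by rewrite ler_pM ?powR_ge0 ?ler_powR// ler1_powR.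
  rewrite -[nu](subrK 1) (@gt0_powRD _ y)// powRr1 ?(ltW y0)// mulrA.
  rewrite ler_pM2r//.
  apply: (@le_trans _ _ (x `^ mu * x `^ (nu - 1))).
    rewrite ler_wpM2l ?powR_ge0// ge0_ler_powR ?nnegrE//; lra.
  rewrite -gt0_powRD// ler_powR//; lra.
- apply: (@le_trans _ _ (x ^+ 2 * (x * y `^ lam))); last first.
    by rewrite ler_pM2l ?exprn_gt0// lerDr mulr_ge0 // ltW.
  have -> : x ^+ 2 * (x * y `^ lam) = x `^ 3 * y `^ lam.
    rewrite -[3]/(3%:R) powR_mulrn ?ltW//; ring.
  rewrite mulrAC -gt0_powRD//.
  have [ml|ml] := leP (mu + lam) 3.
    by rewrite ler_pM ?powR_ge0// ler_powR.
  have -> : mu + lam = 3 + (mu + lam - 3) by ring.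
  rewrite gt0_powRD// -mulrA ler_wpM2l ?powR_ge0//.
  apply: (@le_trans _ _ (y `^ (mu + lam - 3) * y `^ nu)).
    rewrite ler_wpM2r ?powR_ge0// ge0_ler_powR ?nnegrE//; lra.
  rewrite -gt0_powRD// ler_powR//; lra.
Qed.

Section ConvexWeights.
Context {R : realType} (lam : R).
Hypotheses (lam_ge1 : 1 <= lam) (lam_le2 : lam <= 2).

(** For j much larger than n this is about j^(lam - 1), the derivative of j^lam up to a factor; for
    j much smaller than n it is about j^lam / n, which damps the small sizes. *)
Definition slope (n j : nat) : R := j%:R `^ lam / (j%:R + n%:R).
Definition weight (n j : nat) : R := \sum_(i < j) slope n i.+1.

Lemma powR_natr0 : 0%:R `^ lam = 0 :> R.
Proof. by rewrite powR0// lt0r_neq0// (lt_le_trans ltr01). Qed.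

Lemma slope_ge0 n j : 0 <= slope n j.
Proof. by rewrite divr_ge0 ?powR_ge0// addr_ge0. Qed.

Lemma slope0 n : slope n 0 = 0.
Proof. by rewrite /slope powR_natr0 mul0r. Qed.

(** This is the convexity of [weight]: the slope is the product of j^(lam - 1) and j / (j + n), both
    nondecreasing. *)
Lemma slope_homo n i j : (i <= j)%N -> slope n i <= slope n j.
Proof.
elim: j => [|j IH]; first by rewrite leqn0 => /eqP ->.
rewrite leq_eqVlt ltnS => /predU1P[->//|/IH /le_trans]; apply.
have l1 := lam_ge1.
case: j {IH} => [|j]; first by rewrite slope0 slope_ge0.
set x : R := j.+1%:R; have x0 : 0 < x by rewrite ltr0n.
have n0 : 0 <= n%:R :> R by [].
have E : j.+2%:R = x + 1 :> R by rewrite /x -natr1.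
rewrite /slope E -/x ler_pdivrMr; last lra.
rewrite mulrAC ler_pdivlMr; last lra.
have -> : x `^ lam = x `^ (lam - 1) * x by rewrite mulrC mulr_powRB1//; lra.
have -> : (x + 1) `^ lam = (x + 1) `^ (lam - 1) * (x + 1).
  by rewrite mulrC mulr_powRB1//; lra.
have H : x `^ (lam - 1) <= (x + 1) `^ (lam - 1).
  by rewrite ge0_ler_powR ?nnegrE; lra.
rewrite -!mulrA; apply: ler_pM => //; [exact: powR_ge0|nra|nra].
Qed.

(** The slope divided by j^2 is the inverse of j^(2 - lam) (j + n), hence nonincreasing as lam <= 2;
    the cross-multiplied form also covers j = 0. *)
Lemma slope_succ_le n j :
  j%:R ^+ 2 * slope n j.+1 <= j.+1%:R ^+ 2 * slope n j.
Proof.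
case: j => [|j].
  by rewrite expr0n mul0r mulr_ge0 ?slope_ge0 ?exprn_ge0.
have l2 := lam_le2.
set x : R := j.+1%:R; have x0 : 0 < x by rewrite ltr0n.
have n0 : 0 <= n%:R :> R by [].
have E : j.+2%:R = x + 1 :> R by rewrite /x -natr1.
rewrite /slope E -/x mulrA ler_pdivrMr; last lra.
rewrite [X in _ <= X * _]mulrA [X in _ <= X]mulrAC ler_pdivlMr; last lra.
have split y : 0 < y -> y `^ lam = y ^+ 2 * (y `^ (2 - lam))^-1.
  by move=> y0; rewrite -powRN -powR_mulrn ?ltW// -gt0_powRD//; congr (_ `^ _); ring.
rewrite (split x)// (split (x + 1)); last lra.
set p := x `^ _; set q := (x + 1) `^ _.
have p0 : 0 < p by rewrite powR_gt0.
have pq : q^-1 <= p^-1.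
  rewrite lef_pV2 ?posrE ?powR_gt0//; last lra.
  by rewrite ge0_ler_powR ?nnegrE; lra.
have q0 : 0 < q^-1 by rewrite invr_gt0 powR_gt0//; lra.
have -> : x ^+ 2 * ((x + 1) ^+ 2 * q^-1) * (x + n%:R) =
  (x ^+ 2 * (x + 1) ^+ 2) * (q^-1 * (x + n%:R)) by ring.
have -> : (x + 1) ^+ 2 * (x ^+ 2 * p^-1) * (x + 1 + n%:R) =
  (x ^+ 2 * (x + 1) ^+ 2) * (p^-1 * (x + 1 + n%:R)) by ring.
apply: ler_wpM2l; first by rewrite mulr_ge0 ?sqr_ge0.
by apply: ler_pM => //; [exact: ltW|lra|lra].
Qed.

(** By [slope_succ_le], j^2 times the increment is at most (2j + 1) times the slope, and 2j + 1 <=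
    3j for j >= 1. This controls the second difference of [weight]. *)
Lemma slope_incr n j :
  j%:R * (slope n j.+1 - slope n j) <= 3 * slope n j.
Proof.
case: j => [|j]; first by rewrite mul0r mulr_ge0 ?slope_ge0.
have := slope_succ_le n j.+1; have := slope_ge0 n j.+1.
set a := slope _ _; set b := slope _ _ => a0.
rewrite -[j.+2%:R]natr1; have : 1 <= j.+1%:R :> R by rewrite ler1n.
set x : R := j.+1%:R => x1 H.
have : x * (x * (b - a)) <= x * (3 * a) by nra.
by rewrite ler_pM2l//; lra.
Qed.

Lemma weight_succ n j : weight n j.+1 - weight n j = slope n j.+1.
Proof. by rewrite /weight big_ord_recr/= addrAC subrr add0r. Qed.

Lemma weight_ge0 n j : 0 <= weight n j.
Proof. by rewrite sumr_ge0// => i _; exact: slope_ge0. Qed.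

Lemma weight_ub n j : weight n j <= j%:R * slope n j.
Proof.
rewrite mulr_natl -[X in _ *+ X]card_ord -sumr_const; apply: ler_sum => i _.
exact: slope_homo.
Qed.

Lemma weight_lb n j : j%:R * slope n j <= 3 * weight n j.
Proof.
elim: j => [|j IH]; first by rewrite mul0r mulr_ge0 ?weight_ge0.
have /eqP := weight_succ n j; rewrite subr_eq => /eqP ->.
have := slope_succ_le n j; have := slope_ge0 n j.+1; have := slope_ge0 n j.
move: IH; rewrite -[j.+1%:R]natr1.
have : 0 <= j%:R :> R by [].
set a := slope _ _; set b := slope _ _; set x : R := j%:R => x0 IH a0 b0 H.
(* The induction step reduces to (x - 2) b <= x a. The factor (x + 1)^2 is introduced because (x +
   1)^2 (x - 2) = x^3 - (3x + 2), so that x times [slope_succ_le] suffices. *)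
have : (x + 1) ^+ 2 * ((x - 2) * b) <= (x + 1) ^+ 2 * (x * a).
  have : 0 <= (3 * x + 2) * b by rewrite mulr_ge0//; lra.
  have : x * (x ^+ 2 * b) <= x * ((x + 1) ^+ 2 * a) by rewrite ler_wpM2l.
  by nra.
by rewrite ler_pM2l ?exprn_gt0//; lra.
Qed.

Lemma slope0E j : j%:R * slope 0 j = j%:R `^ lam.
Proof.
case: j => [|j]; first by rewrite mul0r powR_natr0.
by rewrite /slope addr0 mulrC divfK// pnatr_eq0.
Qed.

Lemma slope_le n j : j%:R * slope n j <= j%:R `^ lam.
Proof.
case: j => [|j]; first by rewrite mul0r powR_ge0.
by rewrite /slope mulrCA ler_piMr ?powR_ge0// ler_pdivrMr ?mul1r ?lerDl.
Qed.

Lemma powR_le_slope n j : (n <= j)%N ->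
  j%:R `^ lam <= 2 * (j%:R * slope n j).
Proof.
case: j => [|j] nj; first by rewrite powR_natr0 mulr_ge0// mulr_ge0 ?slope_ge0.
have jn : n%:R <= j.+1%:R :> R by rewrite ler_nat.
have j0 : 0 < j.+1%:R :> R by rewrite ltr0n.
have n0 : 0 <= n%:R :> R by [].
rewrite /slope (_ : 2 * _ = j.+1%:R `^ lam * (2 * j.+1%:R / (j.+1%:R + n%:R))).
  rewrite ler_peMr ?powR_ge0// ler_pdivlMr; lra.
by field; rewrite gt_eqF//; lra.
Qed.

End ConvexWeights.

(** * The truncated Euler scheme *)

Lemma discrete_gronwall {R : realType} (a b h : R) (x : nat -> R) (m : nat) :
  0 <= a -> 0 <= b -> 0 <= h -> 0 <= x 0%N ->
  (forall i, (i < m)%N -> x i.+1 <= (1 + a * h) * x i + h * b) ->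
  x m <= (x 0%N + m%:R * h * b) * expR (a * (m%:R * h)).
Proof.
move=> a0 b0 h0 x0; elim: m => [|m IH] H.
  by rewrite !mul0r mulr0 expR0 addr0 mulr1.
have {}IH := IH (fun i im => H i (ltnW im)).
have ah0 : 0 <= a * h by rewrite mulr_ge0.
have E : expR (a * (m.+1%:R * h)) = expR (a * h) * expR (a * (m%:R * h)).
  by rewrite -expRD; congr expR; rewrite -natr1; ring.
have e1 : 1 + a * h <= expR (a * h) by exact: expR_ge1Dx.
have em : 1 <= expR (a * (m.+1%:R * h)).
  by rewrite -expR0 ler_expR mulr_ge0// mulr_ge0.
set e := expR (a * (m%:R * h)) in IH E.
have e0 : 0 <= e by exact: expR_ge0.
apply: (le_trans (H m (ltnSn m))).
have y0 : 0 <= x 0%N + m%:R * h * b by rewrite addr_ge0// !mulr_ge0.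
have -> : (x 0%N + m.+1%:R * h * b) * expR (a * (m.+1%:R * h)) =
   expR (a * h) * ((x 0%N + m%:R * h * b) * e)
   + h * b * expR (a * (m.+1%:R * h)).
  by rewrite E -natr1; ring.
apply: lerD; last by rewrite ler_peMr// mulr_ge0.
apply: (@le_trans _ _ ((1 + a * h) * ((x 0%N + m%:R * h * b) * e))).
  by rewrite ler_wpM2l// addr_ge0.
by rewrite ler_wpM2r// mulr_ge0.
Qed.

(** Abel summation for a discrete continuity equation, in which I j - J j.+1 is the net current from
    size j to size j.+1. The right boundary term will vanish for M = N.+2 by truncation. *)
Lemma sum_flux_by_parts {R : realType} (M : nat) (J I phi : nat -> R) :
  J 0%N = 0 ->
  \sum_(j < M) phi j *
      (J j.+1 - J j - I j + (if (j : nat) is i.+1 then I i else 0)) =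
  \sum_(j < M) (I j - J j.+1) * (phi j.+1 - phi j)
  + phi M * (J M - (if M is i.+1 then I i else 0)).
Proof.
move=> J0; elim: M => [|M IH]; first by rewrite !big_ord0 J0 subr0 mulr0 addr0.
by rewrite !big_ord_recr/= IH; case: M {IH} => [|M]; rewrite ?J0; ring.
Qed.

Section EulerScheme.
Context {R : realType} (K : nat -> nat -> R).
Implicit Types (h b P : R) (f phi c : nat -> R).

Definition rate (c : nat -> R) (N : nat) (f : nat -> R) : R :=
  \sum_(k < N.+1) c k * f k.

(** The zero entry at k = 0 turns the sum over k >= 1 of the import term into a [rate] over the same
    range as the export term. *)
Definition import_kernel (j k : nat) : R := if k is 0%N then 0 else K k j.

(** Exporters have sizes 1 to N and importers sizes 0 to N, so both fluxes count the same exchanges.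
    An importer of size N ends in class N.+1, which takes part in no exchange; hence the N.+2 terms
    of [mom]. *)
Definition outflux (N : nat) (f : nat -> R) (j : nat) : R :=
  if (0 < j <= N)%N then f j * rate (K j) N f else 0.

Definition influx (N : nat) (f : nat -> R) (j : nat) : R :=
  if (j <= N)%N then f j * rate (import_kernel j) N f else 0.

Definition net_flux (N : nat) (f : nat -> R) (j : nat) : R :=
  outflux N f j.+1 - outflux N f j - influx N f j
  + (if j is i.+1 then influx N f i else 0).

Definition euler_step (h : R) (N : nat) (f : nat -> R) (j : nat) : R :=
  f j + h * net_flux N f j.

Definition truncate (N : nat) (f : nat -> R) (j : nat) : R :=
  if (j <= N)%N then f j else 0.

Definition euler (h : R) (N : nat) (f : nat -> R) (i : nat) : nat -> R :=
  iter i (euler_step h N) (truncate N f).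

Definition mom (phi : nat -> R) (N : nat) (f : nat -> R) : R :=
  \sum_(j < N.+2) phi j * f j.

Lemma outflux_eq0 N f j : (N < j)%N -> outflux N f j = 0.
Proof. by move=> Nj; rewrite /outflux (leqNgt j) Nj andbF. Qed.

Lemma influx_eq0 N f j : (N < j)%N -> influx N f j = 0.
Proof. by move=> Nj; rewrite /influx (leqNgt j) Nj. Qed.

(** An exchange turns the exporter j.+1 into j and the importer k into k.+1; the last factor is the
    resulting change of the sum of phi. *)
Lemma mom_step phi h N f :
  mom phi N (euler_step h N f) = mom phi N f +
  h * \sum_(j < N) \sum_(k < N.+1) K j.+1 k * f j.+1 * f k *
        ((phi k.+1 - phi k) - (phi j.+1 - phi j)).
Proof.
rewrite /mom /euler_step.
under eq_bigr do rewrite mulrDr mulrCA.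
rewrite big_split/= -mulr_sumr /net_flux; congr (_ + h * _).
rewrite sum_flux_by_parts// big_ord_recr/= (influx_eq0 _ _ _ (ltnSn N)).
rewrite (outflux_eq0 N f N.+2)// !(subr0, mul0r, mulr0, addr0).
under eq_bigr do rewrite mulrBl.
rewrite sumrB [X in _ - X]big_ord_recr/= outflux_eq0// mul0r addr0.
under [RHS]eq_bigr do (under eq_bigr do rewrite mulrBr; rewrite sumrB).
rewrite sumrB; congr (_ - _).
  (* The import current is indexed by the importer, so importers become the outer index; the
     exporter 0 drops out through [import_kernel]. *)
  rewrite [RHS]exchange_big/=; apply: eq_bigr => j _.
  rewrite /influx -ltnS ltn_ord /rate big_ord_recl/= mul0r add0r.
  rewrite mulr_sumr mulr_suml; apply: eq_bigr => k _.
  by rewrite /bump/=; ring.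
apply: eq_bigr => j _.
rewrite /outflux ltn_ord/= /rate mulr_sumr mulr_suml.
by apply: eq_bigr => k _; ring.
Qed.

Lemma mom_step_const h N f :
  mom (fun=> 1) N (euler_step h N f) = mom (fun=> 1) N f.
Proof.
rewrite mom_step big1 ?mulr0 ?addr0// => j _; rewrite big1// => k _.
by rewrite subrr mulr0.
Qed.

Lemma mom_step_id h N f :
  mom (fun j => j%:R) N (euler_step h N f) = mom (fun j => j%:R) N f.
Proof.
rewrite mom_step big1 ?mulr0 ?addr0// => j _; rewrite big1// => k _.
by rewrite -!natr1; ring.
Qed.

Lemma le_mom phi psi N f : (forall j, 0 <= f j) ->
  (forall j, phi j <= psi j) -> mom phi N f <= mom psi N f.
Proof. by move=> f0 le; apply: ler_sum => j _; rewrite ler_wpM2r. Qed.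

Lemma mom_ge0 phi N f : (forall j, 0 <= f j) ->
  (forall j, 0 <= phi j) -> 0 <= mom phi N f.
Proof. by move=> f0 p0; apply: sumr_ge0 => j _; rewrite mulr_ge0. Qed.

Lemma momZ (a : R) phi N f : mom (fun j => a * phi j) N f = a * mom phi N f.
Proof. by rewrite /mom mulr_sumr; apply: eq_bigr => j _; rewrite mulrA. Qed.

Hypothesis K_ge0 : forall j k, 0 <= K j k.
Hypothesis K_sym : forall j k, K j k = K k j.

Lemma import_kernel_ge0 j k : 0 <= import_kernel j k.
Proof. by case: k => [|k] /=. Qed.

Lemma import_kernel_le j k : import_kernel j k <= K j k.
Proof. by case: k => [|k] //=; rewrite K_sym. Qed.

Lemma rate_ge0 c N f : (forall k, 0 <= c k) -> (forall j, 0 <= f j) ->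
  0 <= rate c N f.
Proof. by move=> c0 f0; apply: sumr_ge0 => k _; rewrite mulr_ge0. Qed.

Lemma outflux_ge0 N f j : (forall j, 0 <= f j) -> 0 <= outflux N f j.
Proof.
by move=> f0; rewrite /outflux; case: ifP => // _; rewrite mulr_ge0// rate_ge0.
Qed.

Lemma influx_ge0 N f j : (forall j, 0 <= f j) -> 0 <= influx N f j.
Proof.
move=> f0; rewrite /influx; case: ifP => // _; rewrite mulr_ge0// rate_ge0//.
exact: import_kernel_ge0.
Qed.

Lemma rate_ub c b N f P : (forall j, 0 <= f j) -> 0 <= b ->
  (forall k, (k <= N)%N -> c k <= b) -> mom (fun=> 1) N f <= P ->
  rate c N f <= b * P.
Proof.
move=> f0 b0 cb fP; apply: (@le_trans _ _ (b * mom (fun=> 1) N f)); last first.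
  by rewrite ler_wpM2l.
rewrite /mom big_ord_recr/= mulrDr mulr_sumr; apply: ler_wpDr.
  by rewrite mul1r mulr_ge0.
by apply: ler_sum => k _; rewrite mul1r ler_wpM2r// cb// -ltnS.
Qed.

(* The CFL condition: in one step no class loses more than it contains. *)
Lemma euler_step_ge0 h N b P f : (forall j, 0 <= f j) -> 0 <= b -> 0 <= h ->
  (forall j k, (j <= N)%N -> (k <= N)%N -> K j k <= b) ->
  mom (fun=> 1) N f <= P -> h * (2 * (b * P)) <= 1 ->
  forall j, 0 <= euler_step h N f j.
Proof.
move=> f0 b0 h0 Kb fP hP j.
have P0 : 0 <= P by rewrite (le_trans _ fP)// mom_ge0.
(* Class j loses at most f j * (b * P) by exporting and as much by importing, whence the factor 2 in
   the condition on h. *)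
have O : outflux N f j <= f j * (b * P).
  rewrite /outflux; case: ifP => [/andP[_ jN]|_]; last by rewrite !mulr_ge0.
  by rewrite ler_wpM2l// rate_ub// => k; exact: Kb.
have I : influx N f j <= f j * (b * P).
  rewrite /influx; case: ifP => jN; last by rewrite !mulr_ge0.
  rewrite ler_wpM2l// rate_ub// => k kN.
  by rewrite (le_trans (import_kernel_le j k))// Kb.
have O' := outflux_ge0 N f j.+1 f0.
have I' : 0 <= (if j is i.+1 then influx N f i else 0).
  by case: j {O I O'} => // i; exact: influx_ge0.
rewrite /euler_step /net_flux; set m := (if j is i.+1 then _ else 0) in I' *.
apply: (@le_trans _ _ (f j - h * (2 * (f j * (b * P))))).
  have := f0 j; nra.
by rewrite lerD2l -mulrN ler_wpM2l//; lra.
Qed.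

(** Between nonempty clusters, exchanging the two indices leaves the symmetric kernel unchanged and
    replaces the increment at k by the increment at j, which forms a second difference. Terms with
    an empty importer compare the first increment of phi with a later one and are nonpositive. *)
Lemma mom_step_convex phi h N f : 0 <= h -> (forall j, 0 <= f j) ->
  (forall j, phi 1%N - phi 0%N <= phi j.+1 - phi j) ->
  mom phi N (euler_step h N f) <= mom phi N f +
  h * \sum_(j < N) \sum_(k < N) K j.+1 k.+1 * f j.+1 * f k.+1 *
        ((phi j.+2 - phi j.+1) - (phi j.+1 - phi j)).
Proof.
move=> h0 f0 cvx; rewrite mom_step lerD2l ler_wpM2l//.
have -> : \sum_(j < N) \sum_(k < N) K j.+1 k.+1 * f j.+1 * f k.+1 *
        ((phi j.+2 - phi j.+1) - (phi j.+1 - phi j)) =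
   \sum_(j < N) \sum_(k < N) K j.+1 k.+1 * f j.+1 * f k.+1 *
        ((phi k.+2 - phi k.+1) - (phi j.+1 - phi j)).
  under eq_bigr do (under eq_bigr do rewrite mulrBr; rewrite sumrB).
  under [RHS]eq_bigr do (under eq_bigr do rewrite mulrBr; rewrite sumrB).
  rewrite !sumrB; congr (_ - _); rewrite exchange_big/=.
  apply: eq_bigr => j _; apply: eq_bigr => k _.
  by rewrite (K_sym k.+1); ring.
apply: ler_sum => j _; rewrite big_ord_recl/= gerDr.
rewrite mulr_ge0_le0 ?mulr_ge0//.
by rewrite subr_le0.
Qed.

Lemma sum_shift_le_mom (phi : nat -> R) N f :
  (forall j, 0 <= phi j) -> (forall j, 0 <= f j) ->
  \sum_(j < N) phi j.+1 * f j.+1 <= mom phi N f.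
Proof.
move=> p0 f0; rewrite /mom big_ord_recl/= big_ord_recr/=.
by rewrite addrCA lerDl addr_ge0// mulr_ge0.
Qed.

(** * Growth of the weighted moments in one step *)

Variables lam A : R.
Hypotheses (lam_ge1 : 1 <= lam) (lam_le2 : lam <= 2) (A_ge0 : 0 <= A).
Hypothesis K_diss : forall j k, (0 < j)%N -> (0 < k)%N ->
  K j k * j%:R `^ lam <= A * (j%:R ^+ 2 * (j%:R `^ lam * k%:R + j%:R * k%:R `^ lam)).

(** This is [j * slope n j] for the exponent lam = 1. It appears as the coefficient of k^lam in
    [kernel_second_difference]. *)
Definition gap_weight (n j : nat) : R := j%:R ^+ 2 / (j%:R + n%:R).

Lemma gap_weight_ge0 n j : 0 <= gap_weight n j.
Proof. by rewrite divr_ge0 ?exprn_ge0// addr_ge0. Qed.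

(** By [slope_incr] the left side is at most 3 K(j,k) j^lam / (j (j + n)); inserting [K_diss] leaves
    the factor j / (j + n) in front of j^lam k + j k^lam. *)
Lemma kernel_second_difference n j k : (0 < j)%N -> (0 < k)%N ->
  K j k * (slope lam n j.+1 - slope lam n j) <=
  3 * A * (j%:R * slope lam n j * k%:R + gap_weight n j * k%:R `^ lam).
Proof.
move=> j0 k0; have x0 : 0 < j%:R :> R by rewrite ltr0n.
have n0 : 0 <= n%:R :> R by [].
have jn0 : 0 < j%:R + n%:R :> R by rewrite ltr_wpDr.
have H := slope_incr lam lam_le2 n j.
have H1 : slope lam n j.+1 - slope lam n j <= 3 * slope lam n j / j%:R.
  by rewrite ler_pdivlMr// mulrC.
apply: (le_trans (ler_wpM2l (K_ge0 j k) H1)).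
have -> : K j k * (3 * slope lam n j / j%:R) =
   (K j k * j%:R `^ lam) * (3 / (j%:R * (j%:R + n%:R))).
  by rewrite /slope; field; rewrite !gt_eqF.
have c0 : 0 <= 3 / (j%:R * (j%:R + n%:R)) :> R.
  by rewrite divr_ge0// mulr_ge0// ltW.
apply: (le_trans (ler_wpM2r c0 (K_diss _ _ j0 k0))).
rewrite le_eqVlt; apply/orP; left; apply/eqP.
by rewrite /slope /gap_weight; field; rewrite !gt_eqF.
Qed.

(** The first product is linear in the weighted moment once the mass is bounded; the second one must
    be absorbed or made small. The inner 3 comes from [weight_lb], the outer one from
    [kernel_second_difference]. *)
Lemma mom_weight_step n h N f : 0 <= h -> (forall j, 0 <= f j) ->
  mom (weight lam n) N (euler_step h N f) <= mom (weight lam n) N f +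
  h * (3 * A * (3 * mom (weight lam n) N f * mom (fun j => j%:R) N f +
       mom (gap_weight n) N f * mom (fun j => j%:R `^ lam) N f)).
Proof.
move=> h0 f0; apply: (le_trans (mom_step_convex (weight lam n) h N f h0 f0 _)).
  by move=> j; rewrite !weight_succ slope_homo.
rewrite lerD2l ler_wpM2l//.
have sl0 j : 0 <= j%:R * slope lam n j by rewrite mulr_ge0 ?slope_ge0.
have M0 (phi : nat -> R) : (forall j, 0 <= phi j) -> 0 <= \sum_(j < N) phi j.+1 * f j.+1.
  by move=> p0; apply: sumr_ge0 => j _; rewrite mulr_ge0.
have p0 j : 0 <= j%:R `^ lam by exact: powR_ge0.
have mS phi := sum_shift_le_mom phi N f.
apply: (@le_trans _ _ (3 * A *
   ((\sum_(j < N) j.+1%:R * slope lam n j.+1 * f j.+1) *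
    (\sum_(k < N) k.+1%:R * f k.+1) +
    (\sum_(j < N) gap_weight n j.+1 * f j.+1) *
    (\sum_(k < N) k.+1%:R `^ lam * f k.+1)))).
  rewrite !big_distrlr/= -big_split/= mulr_sumr; apply: ler_sum => j _.
  rewrite -big_split/= mulr_sumr; apply: ler_sum => k _.
  rewrite !weight_succ.
  rewrite -[leLHS]mulrA -[leLHS]mulrA (mulrCA (f _)) (mulrA (f _)) mulrCA.
  have ff : 0 <= f j.+1 * f k.+1 by rewrite mulr_ge0.
  have := kernel_second_difference n j.+1 k.+1 isT isT.
  move=> /(ler_wpM2l ff) H; apply: le_trans (le_trans H _); last first.
    rewrite le_eqVlt; apply/orP; left; apply/eqP; ring.
  rewrite le_eqVlt; apply/orP; left; apply/eqP; ring.
rewrite ler_wpM2l ?mulr_ge0//; apply: lerD.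
  apply: ler_pM; [exact: M0 _ sl0|exact: (M0 (fun j => j%:R))| |
    exact: (mS (fun j => j%:R))].
  rewrite -momZ; apply: (le_trans (mS _ sl0 f0)); apply: le_mom => // j.
  exact: weight_lb lam lam_le2 n j.
apply: ler_pM; [exact: M0 _ (gap_weight_ge0 n)|exact: M0 _ p0| |
  exact: mS _ p0 f0].
exact: mS _ (gap_weight_ge0 n) f0.
Qed.

(** * Estimates for the iterates, uniform in N and in the step *)

Variables (f0 : nat -> R) (P rho L : R).
Hypothesis f0_ge0 : forall j, 0 <= f0 j.
Hypothesis f0_number : forall n, \sum_(j < n) f0 j <= P.
Hypothesis f0_mass : forall n, \sum_(j < n) j%:R * f0 j <= rho.
Hypothesis f0_moment : forall n, \sum_(j < n) j%:R `^ lam * f0 j <= L.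

Definition cfl h N := 0 <= h /\ exists b, [/\ 0 <= b,
  (forall j k, (j <= N)%N -> (k <= N)%N -> K j k <= b) & h * (2 * (b * P)) <= 1].

Lemma truncate_ge0 N j : 0 <= truncate N f0 j.
Proof. by rewrite /truncate; case: ifP. Qed.

Lemma mom_truncate phi N b : (forall j, 0 <= phi j) ->
  (forall n, \sum_(j < n) phi j * f0 j <= b) -> mom phi N (truncate N f0) <= b.
Proof.
move=> p0 H; apply: le_trans (H N.+2); apply: ler_sum => j _.
by rewrite ler_wpM2l// /truncate; case: ifP.
Qed.

Lemma rho_ge0 : 0 <= rho.
Proof. by have := f0_mass 0; rewrite big_ord0. Qed.

Lemma L_ge0 : 0 <= L.
Proof. by have := f0_moment 0; rewrite big_ord0. Qed.

(** Both claims go through one induction: positivity of the next iterate needs the bound P on the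
    number of clusters of the current one. *)
Lemma euler_admissible h N i : cfl h N ->
  (forall j, 0 <= euler h N f0 i j) /\ mom (fun=> 1) N (euler h N f0 i) <= P.
Proof.
move=> [h0 [b [b0 Kb hb]]]; elim: i => [|i [IH0 IHP]] /=.
  split=> [j|]; first exact: truncate_ge0.
  by apply: mom_truncate => // n; under eq_bigr do rewrite mul1r.
split; first exact: (euler_step_ge0 _ _ b P).
by rewrite mom_step_const.
Qed.

Lemma euler_ge0 h N i j : cfl h N -> 0 <= euler h N f0 i j.
Proof. by move=> /euler_admissible-/(_ i)[]. Qed.

Lemma euler_mass h N i : mom (fun j => j%:R) N (euler h N f0 i) <= rho.
Proof.
elim: i => [|i IH] /=; last by rewrite mom_step_id.
exact: mom_truncate.
Qed.

Lemma euler_eq0 h N i j : (N.+1 < j)%N -> euler h N f0 i j = 0.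
Proof.
move=> Nj; elim: i => [|i IH] /=.
  by rewrite /truncate leqNgt (ltn_trans (ltnSn N)).
have Nj' : (N < j)%N by exact: ltn_trans Nj.
rewrite /euler_step IH /net_flux (outflux_eq0 _ _ _ Nj').
rewrite (outflux_eq0 _ _ _ (leqW Nj')) (influx_eq0 _ _ _ Nj').
case: j Nj {IH Nj'} => // j Nj.
by rewrite influx_eq0// !subr0 addr0 mulr0 addr0.
Qed.

(* The weight with n = 0 is comparable with the moment of order lam, and the
   gap weight is then at most j. *)
Lemma euler_moment h N i T : cfl h N -> i%:R * h <= T ->
  mom (fun j => j%:R `^ lam) N (euler h N f0 i) <=
  3 * (L * expR (18 * A * rho * T)).
Proof.
move=> hN ihT; have h0 := hN.1; have r0 := rho_ge0.
pose u := euler h N f0.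
have u0 i' j : 0 <= u i' j by exact: euler_ge0.
have M3 i' : mom (fun j => j%:R `^ lam) N (u i') <= 3 * mom (weight lam 0) N (u i').
  rewrite -momZ; apply: le_mom => // j.
  by rewrite -(slope0E _ lam_ge1) (weight_lb lam lam_le2 0 j).
apply: (le_trans (M3 i)); rewrite ler_pM2l//.
have w0 i' : 0 <= mom (weight lam 0) N (u i').
  by apply: mom_ge0 => // j; exact: weight_ge0.
(* 18 = 3 * (3 + 3): each of the two products in [mom_weight_step] is at most 3 rho times the
   weighted moment. *)
have a0 : 0 <= 18 * A * rho by rewrite !mulr_ge0.
have := discrete_gronwall (18 * A * rho) 0 h
  (fun i => mom (weight lam 0) N (u i)) i a0 (lexx 0) h0 (w0 0%N).
rewrite (mulr0 (_ * _)) addr0 => H; apply: (le_trans (H _)); last first.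
  apply: ler_pM; [exact: w0 0%N|exact: expR_ge0| |].
    apply: mom_truncate => [j|n]; first exact: weight_ge0.
    apply: le_trans (f0_moment n); apply: ler_sum => j _; rewrite ler_wpM2r//.
    by rewrite -(slope0E _ lam_ge1) weight_ub.
  by rewrite ler_expR ler_wpM2l.
move=> i' _; rewrite mulr0 addr0; apply: (le_trans (mom_weight_step 0 h N _ h0 (u0 i'))).
rewrite [leRHS]mulrDl mul1r lerD2l (mulrC _ h) -[leRHS]mulrA.
apply: ler_wpM2l => //; rewrite -!mulrA.
set x := mom (weight _ _) _ _; have x0 : 0 <= x by exact: w0.
have H1 : mom (fun j => j%:R) N (u i') <= rho by exact: euler_mass.
have H2 : mom (gap_weight 0) N (u i') * mom (fun j => j%:R `^ lam) N (u i')
    <= rho * (3 * x).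
  apply: ler_pM => //.
  - by apply: mom_ge0 => // j; exact: gap_weight_ge0.
  - by apply: mom_ge0 => // j; exact: powR_ge0.
  apply: le_trans H1; apply: le_mom => // j; rewrite /gap_weight addr0.
  by case: j => [|j]; rewrite ?expr0n ?mul0r// expr2 mulfK// pnatr_eq0.
have H3 : 3 * x * mom (fun j => j%:R) N (u i') <= 3 * x * rho.
  by rewrite ler_wpM2l// mulr_ge0.
rewrite -mulrA in H3.
have -> : 18 * (A * (rho * x)) = 3 * (A * (3 * x * rho + rho * (3 * x))) by ring.
by rewrite ler_pM2l// ler_wpM2l// lerD.
Qed.

(** The sizes are split at y, where y^(lam - 1) = 1 / eps. Above y the gap weight is at most j <=
    eps j^lam; below y it is at most j^2 / n <= eps j as soon as n >= y / eps. For lam = 1 there is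
    no such smallness, since the gap weight is close to j for j much larger than n. *)
Lemma gap_weight_small (eps : R) : 1 < lam -> 0 < eps ->
  exists n0 : nat, forall n j : nat, (n0 <= n)%N ->
  gap_weight n j <= eps * j%:R `^ lam.
Proof.
move=> l1 e0.
pose y : R := (eps^-1) `^ (lam - 1)^-1.
have y0 : 0 <= y by exact: powR_ge0.
exists (Num.truncn (y / eps)).+1 => n j n0n.
have ny : y / eps < n%:R.
  by rewrite (lt_le_trans (truncnS_gt _))// ler_nat.
case: j => [|j].
  by rewrite /gap_weight expr0n mul0r mulr_ge0 ?powR_ge0// ltW.
set x : R := j.+1%:R; have x1 : 1 <= x by rewrite ler1n.
have x0 : 0 < x by lra.
have n0 : 0 <= n%:R :> R by [].
have xl : x `^ lam = x * x `^ (lam - 1) by rewrite mulr_powRB1//; lra.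
have [yx|xy] := leP y x.
  apply: (@le_trans _ _ x).
    rewrite /gap_weight -/x ler_pdivrMr; last lra.
    by rewrite expr2 ler_wpM2l; lra.
  rewrite xl mulrCA ler_peMr; [by []|lra|].
  have : eps^-1 <= x `^ (lam - 1).
    have -> : eps^-1 = y `^ (lam - 1).
      by rewrite /y -powRrM mulVf ?powRr1 ?invr_ge0 ?ltW// gt_eqF//; lra.
    by rewrite ge0_ler_powR ?nnegrE; lra.
  by move=> /(ler_wpM2l (ltW e0)); rewrite divff// gt_eqF.
apply: (@le_trans _ _ (eps * x)); last first.
  by rewrite ler_pM2l// le1r_powR// ltW.
rewrite /gap_weight -/x ler_pdivrMr; last lra.
move: ny; rewrite ltr_pdivrMr// => ny.
have : x * x <= x * (n%:R * eps) by rewrite ler_wpM2l; lra.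
have : 0 <= eps * (x * x) by rewrite mulr_ge0 ?mulr_ge0//; lra.
rewrite expr2; nra.
Qed.

(** Dominated convergence by hand: beyond a size M the weights are bounded by j^lam, whose tail is
    at most eps / 2, and below M they carry a factor j / (j + n) <= M / n. *)
Lemma initial_weight_small (eps : R) : 0 < eps ->
  exists n0 : nat, forall n m : nat, (n0 <= n)%N ->
  \sum_(j < m) j%:R * slope lam n j * f0 j <= eps.
Proof.
move=> e0; pose S (m : nat) := \sum_(j < m) j%:R `^ lam * f0 j.
have p0 j : 0 <= j%:R `^ lam * f0 j by rewrite mulr_ge0 ?powR_ge0.
have Smono m m' : (m <= m')%N -> S m <= S m'.
  move=> /subnK <-; elim: (m' - m)%N => // d IH.
  by rewrite addSn /S big_ord_recr/= (le_trans IH)// lerDl.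
have supS : has_sup (range S).
  by split; [exists (S 0%N), 0%N|exists L => _ [m _ <-]; exact: f0_moment].
have [_ [M _ <-] SM] := sup_adherent (divr_gt0 e0 (ltr0n _ 2)) supS.
have Sle m : S m <= sup (range S).
  by apply: (sup_upper_bound supS); exists m.
exists (Num.truncn (2 * M%:R * L / eps)).+1 => n m nn.
have n0 : 0 < n%:R :> R by rewrite ltr0n (leq_trans _ nn).
have nL : 2 * M%:R * L <= eps * n%:R.
  rewrite [leRHS]mulrC -ler_pdivrMr//; apply: ltW.
  by apply: lt_le_trans (truncnS_gt _) _; rewrite ler_nat.
have L0 := L_ge0.
apply: (@le_trans _ _ (\sum_(j < m)
   (M%:R / n%:R * (j%:R `^ lam * f0 j) +
    (if (M <= j)%N then j%:R `^ lam * f0 j else 0)))).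
  apply: ler_sum => j _; case: ifPn => Mj.
    apply: ler_wpDl; first by rewrite mulr_ge0// divr_ge0// ltW.
    by rewrite ler_wpM2r// slope_le.
  rewrite -ltnNge in Mj; rewrite addr0 [leRHS]mulrA ler_wpM2r// /slope.
  rewrite mulrCA [leRHS]mulrC ler_wpM2l ?powR_ge0//.
  rewrite ler_pdivlMr// mulrAC ler_pdivrMr ?ltr_wpDl//.
  rewrite mulrDr; apply: ler_wpDl; first by rewrite mulr_ge0.
  by rewrite ler_wpM2r ?(ltW n0)// ler_nat ltnW.
rewrite big_split/= -mulr_sumr.
have H1 : M%:R / n%:R * \sum_(j < m) j%:R `^ lam * f0 j <= eps / 2.
  apply: (@le_trans _ _ (M%:R / n%:R * L)).
    by rewrite ler_wpM2l// divr_ge0// ltW.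
  rewrite mulrAC ler_pdivrMr//; lra.
have H2 : \sum_(j < m) (if (M <= j)%N then j%:R `^ lam * f0 j else 0)
    <= S m - S (minn m M).
  elim: (m) => [|k IH]; first by rewrite big_ord0 min0n /S big_ord0 subr0.
  rewrite big_ord_recr/=; case: ifPn => Mk.
    have -> : S k.+1 = S k + k%:R `^ lam * f0 k by rewrite /S big_ord_recr.
    move: IH; rewrite (minn_idPr Mk) (minn_idPr (leqW Mk)); lra.
  rewrite -ltnNge in Mk; move: IH.
  by rewrite (minn_idPl Mk) (minn_idPl (ltnW Mk)) !subrr addr0.
have H3 : S m - S (minn m M) <= eps / 2.
  have [mM|Mm] := leqP m M.
    by rewrite subrr; lra.
  have := Sle m; move: SM; lra.
move: H1 H2 H3; lra.
Qed.

Lemma euler_weight_small (T eps : R) : 0 <= T -> 0 < eps ->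
  exists n : nat, forall h N i, cfl h N -> i%:R * h <= T ->
  mom (weight lam n) N (euler h N f0 i) <= eps.
Proof.
move=> T0 e0; have r0 := rho_ge0; have L0 := L_ge0.
pose e := expR (18 * A * rho * T); have ee : 0 < e by exact: expR_gt0.
pose B := 3 * (L * e).
have B0 : 0 <= B by rewrite !mulr_ge0// ltW.
(* Half of eps pays for the initial datum and half for the accumulated source, both amplified by the
   Gronwall factor e. The summand 1 keeps Q positive when the source is zero. *)
pose Q := T * (3 * A * B ^+ 2) * e + 1.
have Q0 : 0 < Q.
  by rewrite ltr_wpDl// !mulr_ge0// ?sqr_ge0// ltW.
pose eps1 := eps / (2 * e); pose eps2 := eps / (2 * Q).
have e1 : 0 < eps1 by rewrite divr_gt0// mulr_gt0.
have e2 : 0 < eps2 by rewrite divr_gt0// mulr_gt0.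
have [n1 Hn1] := initial_weight_small eps1 e1.
have [n2 Hn2] : exists n2 : nat, 1 < lam -> forall n j, (n2 <= n)%N ->
    gap_weight n j <= eps2 * j%:R `^ lam.
  have [l1|l1] := leP lam 1; first by exists 0%N.
  by have [n2 Hn2] := gap_weight_small eps2 l1 e2; exists n2.
pose n := maxn n1 n2; exists n => h N i hN ihT; have h0 := hN.1.
pose u := euler h N f0.
have u0 i' j : 0 <= u i' j by exact: euler_ge0.
have w0 i' : 0 <= mom (weight lam n) N (u i').
  by apply: mom_ge0 => // j; exact: weight_ge0.
have a0 : 0 <= 18 * A * rho by rewrite !mulr_ge0.
have e20 : 0 <= eps2 * B ^+ 2 by apply: mulr_ge0; [exact: ltW|exact: sqr_ge0].
have b0 : 0 <= 3 * A * (eps2 * B ^+ 2) by rewrite mulr_ge0// mulr_ge0.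
have := discrete_gronwall (18 * A * rho) (3 * A * (eps2 * B ^+ 2)) h
  (fun i => mom (weight lam n) N (u i)) i a0 b0 h0 (w0 0%N).
move=> H; apply: (le_trans (H _)); last first.
  apply: (@le_trans _ _ ((eps1 + T * (3 * A * (eps2 * B ^+ 2))) * e)).
    apply: ler_pM; [|exact: expR_ge0| |].
    - by rewrite addr_ge0// ?w0// mulr_ge0// mulr_ge0.
    - apply: lerD; last by rewrite ler_wpM2r.
      apply: (@le_trans _ _ (mom (fun j => j%:R * slope lam n j) N (u 0%N))).
        by apply: le_mom => // j; exact: weight_ub.
      apply: mom_truncate => [j|m]; first by rewrite mulr_ge0 ?slope_ge0.
      by apply: Hn1; rewrite leq_maxl.
    - by rewrite ler_expR ler_wpM2l.
  have -> : (eps1 + T * (3 * A * (eps2 * B ^+ 2))) * e =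
     eps / 2 + eps / 2 * ((Q - 1) / Q).
    rewrite /eps1 /eps2 /Q; field; rewrite -/Q !gt_eqF//.
  have : (Q - 1) / Q <= 1 by rewrite ler_pdivrMr//; lra.
  move: ((Q - 1) / Q) => q q1; nra.
move=> i' i'i; apply: (le_trans (mom_weight_step n h N _ h0 (u0 i'))).
have i'T : i'%:R * h <= T.
  by apply: le_trans ihT; rewrite ler_wpM2r// ler_nat ltnW.
set x := mom (weight _ _) _ _; have x0 : 0 <= x by exact: w0.
have H1 : mom (fun j => j%:R) N (u i') <= rho by exact: euler_mass.
have pB : mom (fun j => j%:R `^ lam) N (u i') <= B by exact: euler_moment.
have p0 : 0 <= mom (fun j => j%:R `^ lam) N (u i').
  by apply: mom_ge0 => // j; exact: powR_ge0.
have g0 : 0 <= mom (gap_weight n) N (u i').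
  by apply: mom_ge0 => // j; exact: gap_weight_ge0.
have H2 : mom (gap_weight n) N (u i') * mom (fun j => j%:R `^ lam) N (u i')
    <= 3 * x * rho + eps2 * B ^+ 2.
  (* For lam = 1 the gap weight is [j * slope n j], at most three times the weight itself, and the
     second product goes into the Gronwall rate. For lam > 1 it is a source of size eps2 * B^2. *)
  have [l1|l1] := leP lam 1.
    have {}l1 : lam = 1 by apply/eqP; rewrite eq_le l1 lam_ge1.
    apply: ler_wpDr => //.
    apply: ler_pM => //; last first.
      by apply: le_trans H1; apply: le_mom => // j; rewrite l1 powRr1.
    rewrite -momZ; apply: le_mom => // j.
    apply: le_trans (weight_lb lam lam_le2 n j).
    by rewrite /gap_weight /slope l1 powRr1// expr2 mulrA.
  apply: ler_wpDl; first by rewrite !mulr_ge0.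
  rewrite expr2 mulrA; apply: ler_pM => //.
  apply: (@le_trans _ _ (eps2 * mom (fun j => j%:R `^ lam) N (u i'))).
    rewrite -momZ; apply: le_mom => // j; apply: Hn2 => //.
    by rewrite leq_maxr.
  by rewrite ler_wpM2l// ltW.
have H3 : 3 * x * mom (fun j => j%:R) N (u i') <= 3 * x * rho.
  by rewrite ler_wpM2l// mulr_ge0.
have -> : (1 + 18 * A * rho * h) * x + h * (3 * A * (eps2 * B ^+ 2)) =
  x + h * (3 * A * (3 * x * rho + (3 * x * rho + eps2 * B ^+ 2))) by ring.
rewrite lerD2l ler_wpM2l//; apply: ler_wpM2l; first by rewrite mulr_ge0.
exact: lerD.
Qed.

Lemma sum_le_mom phi h N i (m : nat) : cfl h N -> (forall j, 0 <= phi j) ->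
  \sum_(j < m) phi j * euler h N f0 i j <= mom phi N (euler h N f0 i).
Proof.
move=> hN p0; have t0 j : 0 <= phi j * euler h N f0 i j.
  by rewrite mulr_ge0// euler_ge0.
elim: m => [|m IH]; first by rewrite big_ord0 mom_ge0// => j; exact: euler_ge0.
have [mN|Nm] := leqP m.+1 N.+2; last first.
  by rewrite big_ord_recr/= (euler_eq0 _ _ _ m)// mulr0 addr0.
rewrite /mom -(subnKC mN) big_split_ord/= lerDl sumr_ge0//.
Qed.

Lemma euler_tail (T eps : R) : 0 <= T -> 0 < eps ->
  exists n : nat, forall h N i m, cfl h N -> i%:R * h <= T ->
  \sum_(n <= j < m) j%:R `^ lam * euler h N f0 i j <= eps.
Proof.
move=> T0 e0.
(* 6 = 2 * 3: beyond n, j^lam is at most twice [j * slope n j], itself at most three times the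
   weight. *)
have [n Hn] := euler_weight_small T (eps / 6) T0 (divr_gt0 e0 (ltr0n _ 6)).
exists n => h N i m hN ihT.
have t0 j : 0 <= 6 * weight lam n j * euler h N f0 i j.
  by rewrite !mulr_ge0 ?weight_ge0 ?euler_ge0.
apply: (@le_trans _ _ (\sum_(0 <= j < m) 6 * weight lam n j * euler h N f0 i j)).
  have [nm|mn] := leqP n m; last first.
    by rewrite big_geq ?(ltnW mn)// sumr_ge0.
  rewrite [leRHS](big_cat_nat (leq0n n) nm)/=; apply: ler_wpDl; first by rewrite sumr_ge0.
  rewrite !big_nat; apply: ler_sum => j /andP[nj _].
  rewrite ler_wpM2r ?euler_ge0//.
  have := powR_le_slope lam lam_ge1 n j nj; have := weight_lb lam lam_le2 n j; lra.
rewrite big_mkord.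
apply: (le_trans (sum_le_mom (fun j => 6 * weight lam n j) h N i m hN _)).
  by move=> j; rewrite mulr_ge0 ?weight_ge0.
by rewrite momZ; have := Hn _ _ _ hN ihT; lra.
Qed.

End EulerScheme.

(** * Ultrafilter limits of step functions *)

Section StepFunctionLimits.
Context {R : realType} (U : set_system nat) {UU : UltraFilter U} (h : nat -> R).
Hypothesis U_oo : \oo `<=` U.
Hypothesis h_gt0 : forall N, 0 < h N.
Hypothesis h_cvg : h @ \oo --> 0.
Implicit Types X : nat -> nat -> R.

Definition bounded_family X := forall T : R, exists B : R,
  forall N i, i%:R * h N <= T -> `|X N i| <= B.

Definition equicontinuous_family X := forall T eps : R, 0 < eps ->
  exists2 d : R, 0 < d & forall N i i', (i <= i')%N -> i'%:R * h N <= T ->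
    (i'%:R - i%:R) * h N <= d -> `|X N i' - X N i| <= eps.

(** Since [Num.truncn] sends negative numbers to 0, the step functions and their limits are constant
    for t <= 0, and continuity can be proved on the whole line. *)
Definition step_index (N : nat) (t : R) : nat := Num.truncn (t / h N).

Definition family_at X (t : R) (N : nat) : R := X N (step_index N t).

Definition family_lim X (t : R) : R := lim (family_at X t @ U).

Definition riemann_sum X (N i : nat) : R := h N * \sum_(l < i) X N l.

Lemma hU_cvg : h @ U --> 0.
Proof. by apply: cvg_trans h_cvg => A; exact: U_oo. Qed.

Lemma step_index_le N t : 0 <= t -> (step_index N t)%:R * h N <= t.
Proof. by move=> t0; rewrite -ler_pdivlMr// truncn_le divr_ge0// ltW. Qed.

Lemma step_index_gt N t : t < ((step_index N t)%:R + 1) * h N.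
Proof. by rewrite -ltr_pdivrMr// natr1 truncnS_gt. Qed.

Lemma step_index_neg N t : t <= 0 -> step_index N t = 0%N.
Proof.
move=> t0; apply/eqP; rewrite -leqn0 truncn_le_nat.
by rewrite (@le_lt_trans _ _ 0)// pmulr_lle0 ?invr_gt0.
Qed.

Lemma step_index_mono N s t : s <= t -> (step_index N s <= step_index N t)%N.
Proof.
move=> st; have [t0|t0] := leP t 0.
  by rewrite !step_index_neg// (le_trans st).
rewrite /step_index truncn_le_nat; apply: (@le_lt_trans _ _ (t / h N)).
  by rewrite ler_wpM2r// invr_ge0 ltW.
exact: truncnS_gt.
Qed.

Lemma step_index_le_max N t : (step_index N t)%:R * h N <= Num.max t 0.
Proof.
have [t0|t0] := leP t 0; first by rewrite step_index_neg// mul0r.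
by rewrite step_index_le// ltW.
Qed.

Lemma step_index_gap N s t : s <= t ->
  ((step_index N t)%:R - (step_index N s)%:R) * h N <= t - s + h N.
Proof.
move=> st; have hN := h_gt0 N; have := step_index_gt N s.
have [t0|t0] := leP t 0.
  have s0 : s <= 0 by lra.
  by rewrite !step_index_neg// subrr mul0r; lra.
have := step_index_le N t (ltW t0); lra.
Qed.

(** Compactness of the segment gives a cluster point. For each neighbourhood the ultrafilter
    contains its preimage or the complement of it, and the second case contradicts clustering. *)
Lemma bounded_cvg_ultra (x : nat -> R) (B : R) :
  (forall N, `|x N| <= B) -> cvg (x @ U).
Proof.
move=> xB; have [|l [_ xl]] := @segment_compact R (- B) B (x @ U) _.
  by apply: (@filterE _ U) => N /=; rewrite in_itv/= -ler_norml.
apply/cvg_ex; exists l => V lV.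
case: (in_ultra_setVsetC (x @^-1` V) UU) => // UV.
by have [y [VCy Vy]] := xl (~` V) V UV lV.
Qed.

Lemma family_cvg X t : bounded_family X ->
  family_at X t @ U --> family_lim X t.
Proof.
move=> /(_ (Num.max t 0))[B XB]; apply: (bounded_cvg_ultra _ B) => N.
exact/XB/step_index_le_max.
Qed.

Lemma family_limE X t l : family_at X t @ U --> l -> family_lim X t = l.
Proof. exact: cvg_lim. Qed.

Lemma family_lim_near X : bounded_family X -> equicontinuous_family X ->
  forall T eps : R, 0 < eps -> exists2 d : R, 0 < d & forall s t : R,
  s <= t -> t <= T -> t - s < d -> `|family_lim X t - family_lim X s| <= eps.
Proof.
move=> bX eX T eps e0; have [d d0 Hd] := eX (Num.max T 0) eps e0.
exists d => // s t st tT tsd.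
have H : `|family_at X t N - family_at X s N| @[N --> U] -->
    `|family_lim X t - family_lim X s|.
  by apply: cvg_norm; apply: cvgB; exact: family_cvg.
(* The strict inequality t - s < d leaves room for the rounding error h N of [step_index_gap], for
   U-almost all N. *)
have hd : 0 < d - (t - s) by lra.
apply: (cvgr_to_le H).
apply: filterS (cvgr_le _ hU_cvg _ hd) => N hN.
apply: Hd; first exact: step_index_mono.
  by apply: (le_trans (step_index_le_max N t)); rewrite ge_max !le_max tT lexx/= orbT.
by apply: (le_trans (step_index_gap N s t st)); lra.
Qed.

Lemma family_lim_continuous X : bounded_family X -> equicontinuous_family X ->
  continuous (family_lim X).
Proof.
move=> bX eX t; apply/cvgrPdist_le => eps e0.
have [d d0 Hd] := family_lim_near X bX eX (t + 1) eps e0.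
have m0 : 0 < Num.min d 1 by rewrite lt_min d0 ltr01.
near=> s.
have : `|t - s| < Num.min d 1 by near: s; exact: cvgr_dist_lt.
rewrite lt_min ltr_norml => /andP[/andP[d1 d2]]; rewrite ltr_norml => /andP[d3 d4].
have [st|ts] := leP s t; first by apply: Hd => //; lra.
by rewrite distrC; apply: Hd; lra.
Unshelve. all: by end_near. Qed.

Lemma riemann_sum_bounded X : bounded_family X -> bounded_family (riemann_sum X).
Proof.
move=> bX T; have [B XB] := bX T; exists (T * B) => N i iT.
have hN := h_gt0 N.
rewrite /riemann_sum normrM gtr0_norm//.
apply: (@le_trans _ _ (h N * (i%:R * B))).
  rewrite ler_pM2l// (le_trans (ler_norm_sum _ _ _))//.
  rewrite mulr_natl -[X in _ *+ X]card_ord -sumr_const; apply: ler_sum => l _.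
  by apply: XB; apply: le_trans iT; rewrite ler_pM2r// ler_nat ltnW.
have [i0|i0] := posnP i; last first.
  have B0 : 0 <= B by apply: le_trans (XB N i iT).
  by rewrite mulrCA mulrA ler_wpM2r.
rewrite i0 mul0r in iT *; rewrite mul0r mulr0 mulr_ge0//.
by rewrite (le_trans _ (XB N 0%N _))// mul0r.
Qed.

Lemma riemann_sum_sub X N i i' : (i <= i')%N ->
  riemann_sum X N i' - riemann_sum X N i = h N * \sum_(i <= l < i') X N l.
Proof.
move=> ii'; rewrite /riemann_sum -mulrBr; congr (_ * _).
by rewrite -!(big_mkord xpredT) (big_cat_nat (leq0n i) ii')/= addrAC subrr add0r.
Qed.

Lemma sumr_nat_const (i i' : nat) (c : R) : (i <= i')%N ->
  \sum_(i <= l < i') c = (i'%:R - i%:R) * c.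
Proof. by move=> ii'; rewrite sumr_const_nat -natrB// mulr_natl. Qed.

Lemma riemann_sum_equicontinuous X : bounded_family X ->
  equicontinuous_family (riemann_sum X).
Proof.
move=> bX T eps e0; have [B XB] := bX T.
pose B' := Num.max B 1; have B0 : 0 < B' by rewrite lt_max ltr01 orbT.
exists (eps / B'); first exact: divr_gt0.
move=> N i i' ii' iT id; rewrite riemann_sum_sub// normrM gtr0_norm//.
apply: (@le_trans _ _ (h N * ((i'%:R - i%:R) * B'))).
  rewrite ler_pM2l// (le_trans (ler_norm_sum _ _ _))// -sumr_nat_const//.
  rewrite !big_nat; apply: ler_sum => l /andP[_ li].
  rewrite (@le_trans _ _ B)// ?le_max ?lexx//.
  by apply: XB; apply: le_trans iT; rewrite ler_pM2r// ler_nat ltnW.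
by rewrite mulrCA mulrA -ler_pdivlMr.
Qed.

(** Between s and t the values X N l differ from the one at s by at most eps, and the total length
    of the steps differs from t - s by at most h N; the second error disappears in the limit. *)
Lemma riemann_sum_increment X : bounded_family X -> equicontinuous_family X ->
  forall T eps : R, 0 < eps -> exists2 d : R, 0 < d & forall s t : R,
  0 <= s -> s <= t -> t <= T -> t - s < d ->
  `|family_lim (riemann_sum X) t - family_lim (riemann_sum X) s
    - (t - s) * family_lim X s| <= (t - s) * eps.
Proof.
move=> bX eX T eps e0.
have [d d0 Hd] := eX T eps e0; have [B XB] := bX T.
exists d => // s t s0 st tT tsd.
have bC := riemann_sum_bounded X bX.
have H1 : `|family_at (riemann_sum X) t N - family_at (riemann_sum X) s N
      - (t - s) * family_at X s N| @[N --> U] -->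
    `|family_lim (riemann_sum X) t - family_lim (riemann_sum X) s
      - (t - s) * family_lim X s|.
  apply: cvg_norm; apply: cvgB; last by apply: cvgMr; exact: family_cvg.
  by apply: cvgB; exact: family_cvg.
have H2 : (fun N => (t - s + h N) * eps + h N * B) @ U --> (t - s + 0) * eps + 0 * B.
  apply: cvgD; apply: cvgMl; last exact: hU_cvg.
  by apply: cvgD; [exact: cvg_cst|exact: hU_cvg].
rewrite mul0r !addr0 in H2.
apply: (ler_cvg_to H1 H2); have hd : 0 < d - (t - s) by lra.
apply: filterS (cvgr_le _ hU_cvg _ hd) => N hNd /=.
have hN := h_gt0 N.
rewrite /family_at.
have := step_index_le N t (le_trans s0 st); have := step_index_gt N t.
have := step_index_le N s s0; have := step_index_gt N s.
have := step_index_gap N s t st; have := step_index_mono N s t st.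
set i := step_index N s; set i' := step_index N t => ii' gap s1 s2 t1 t2.
rewrite riemann_sum_sub//.
have -> : h N * \sum_(i <= l < i') X N l - (t - s) * X N i =
  h N * (\sum_(i <= l < i') (X N l - X N i)) +
  ((i'%:R - i%:R) * h N - (t - s)) * X N i.
  by rewrite sumrB sumr_nat_const//; ring.
apply: (le_trans (ler_normD _ _)); apply: lerD.
  rewrite normrM gtr0_norm//.
  apply: (@le_trans _ _ (h N * ((i'%:R - i%:R) * eps))).
    rewrite ler_pM2l// (le_trans (ler_norm_sum _ _ _))// -sumr_nat_const//.
    rewrite !big_nat; apply: ler_sum => l /andP[il li].
    have l1 : l%:R <= i'%:R :> R by rewrite ler_nat ltnW.
    apply: Hd => //.
      by apply: (@le_trans _ _ (i'%:R * h N)); [rewrite ler_pM2r|lra].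
    apply: (@le_trans _ _ ((i'%:R - i%:R) * h N)); last lra.
    by rewrite ler_pM2r// lerD2r.
  by rewrite mulrCA mulrA ler_pM2r.
rewrite normrM ler_pM//.
  by rewrite ler_norml; apply/andP; split; lra.
by apply: XB; lra.
Qed.

Lemma riemann_sum_lim0 X : family_lim (riemann_sum X) 0 = 0.
Proof.
apply: family_limE; rewrite (_ : family_at _ _ = cst 0); first exact: cvg_cst.
by apply/funext => N; rewrite /family_at step_index_neg// /riemann_sum big_ord0 mulr0.
Qed.

Lemma riemann_sum_lim_quotient X (t : R) :
  bounded_family X -> equicontinuous_family X -> 0 < t ->
  k^-1 *: (family_lim (riemann_sum X) (k + t) - family_lim (riemann_sum X) t)
    @[k --> 0^'] --> family_lim X t.
Proof.
move=> bX eX t0; apply/cvgrPdist_le => eps e0.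
have e20 : 0 < eps / 2 by rewrite divr_gt0.
have [d d0 Hd] := riemann_sum_increment X bX eX (t + 1) (eps / 2) e20.
have [d' d'0 Hd'] := family_lim_near X bX eX (t + 1) (eps / 2) e20.
(* The bound t keeps k + t nonnegative and the bound 1 keeps it below t + 1. For k < 0 the increment
   is based at k + t, and d' pays for replacing the slope there by the slope at t. *)
pose m := Num.min (Num.min d d') (Num.min t 1).
have m0 : 0 < m by rewrite !lt_min d0 d'0 t0 ltr01.
near=> k.
have k0 : k != 0 by near: k; exact: nbhs_dnbhs_neq.
have : `|k| < m by near: k; exact: dnbhs0_lt.
rewrite !lt_min => /andP[/andP[kd kd'] /andP[kt k1]].
have kk : 0 < `|k| by rewrite normr_gt0.
set c := family_lim (riemann_sum X); set x := family_lim X.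
rewrite -(ler_pM2l kk) -normrM mulrBr /GRing.scale/= mulrA divff// mul1r.
rewrite distrC.
have [kpos|kneg] := ltP 0 k.
  rewrite (gtr0_norm kpos) in kd kt k1 kk *.
  have -> : c (k + t) - c t - k * x t = c (k + t) - c t - (k + t - t) * x t by ring.
  apply: (@le_trans _ _ ((k + t - t) * (eps / 2))); first by apply: Hd; lra.
  by rewrite addrK; nra.
have {}kneg : k < 0 by rewrite lt_neqAle k0.
rewrite (ltr0_norm kneg) in kd kd' kt k1 kk *.
have -> : c (k + t) - c t - k * x t =
  - (c t - c (k + t) - (t - (k + t)) * x (k + t)) - k * (x t - x (k + t)) by ring.
apply: (le_trans (ler_normB _ _)); rewrite normrN.
have H1 : `|c t - c (k + t) - (t - (k + t)) * x (k + t)| <= (t - (k + t)) * (eps / 2).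
  by apply: Hd; lra.
have H2 : `|k * (x t - x (k + t))| <= - k * (eps / 2).
  by rewrite normrM (ltr0_norm kneg) ler_pM2l//; apply: Hd'; lra.
apply: (le_trans (lerD H1 H2)); lra.
Unshelve. all: by end_near. Qed.

(** Dominated convergence holds for sequences, not along an ultrafilter, so integrals are not passed
    to the limit: the limit of the Riemann sums is a primitive of a continuous function, and the
    fundamental theorem of calculus applies. *)
Lemma riemann_sum_lim_integral X (t : R) :
  bounded_family X -> equicontinuous_family X -> 0 <= t ->
  (\int[lebesgue_measure]_(s in `[0%R, t]) (family_lim X s)%:E =
   (family_lim (riemann_sum X) t)%:E)%E.
Proof.
move=> bX eX; rewrite le_eqVlt => /predU1P[<-|t0].
  by rewrite set_itv1 integral_set1 riemann_sum_lim0.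
have cc : continuous (family_lim (riemann_sum X)).
  apply: family_lim_continuous; first exact: riemann_sum_bounded.
  exact: riemann_sum_equicontinuous.
have dc s : s \in `]0, t[ -> derivable (family_lim (riemann_sum X)) s 1.
  rewrite in_itv/= => /andP[s0 st].
  rewrite /derivable; apply/cvg_ex; exists (family_lim X s).
  under eq_fun do rewrite [_ *: 1]mulr1.
  exact: riemann_sum_lim_quotient.
rewrite (@continuous_FTC2 _ _ (family_lim (riemann_sum X)))//.
- by rewrite riemann_sum_lim0 sube0.
- by apply: continuous_subspaceT; exact: family_lim_continuous.
- split => //; first exact: cvg_at_right_filter (cc 0).
  exact: cvg_at_left_filter (cc t).
move=> s; rewrite in_itv/= => /andP[s0 st].
by rewrite /derive1; apply: cvg_lim => //; exact: riemann_sum_lim_quotient.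
Qed.

(** * Stability of bounded and equicontinuous families *)

Lemma bounded_familyM X1 X2 : bounded_family X1 -> bounded_family X2 ->
  bounded_family (fun N i => X1 N i * X2 N i).
Proof.
move=> b1 b2 T; have [B1 H1] := b1 T; have [B2 H2] := b2 T.
by exists (B1 * B2) => N i iT; rewrite normrM ler_pM ?H1 ?H2.
Qed.

Lemma equicontinuous_familyM X1 X2 : bounded_family X1 -> bounded_family X2 ->
  equicontinuous_family X1 -> equicontinuous_family X2 ->
  equicontinuous_family (fun N i => X1 N i * X2 N i).
Proof.
move=> b1 b2 e1 e2 T eps e0; have [B1 H1] := b1 T; have [B2 H2] := b2 T.
pose B := Num.max 1 (Num.max B1 B2).
have B0 : 0 < B by rewrite lt_max ltr01.
have eB : 0 < eps / (2 * B) by rewrite divr_gt0// mulr_gt0.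
have [d1 d10 Hd1] := e1 T _ eB; have [d2 d20 Hd2] := e2 T _ eB.
exists (Num.min d1 d2); first by rewrite lt_min d10.
move=> N i i' ii' iT; rewrite le_min => /andP[id1 id2].
have iT' : i%:R * h N <= T by apply: le_trans iT; rewrite ler_pM2r// ler_nat.
have -> : X1 N i' * X2 N i' - X1 N i * X2 N i =
  X1 N i' * (X2 N i' - X2 N i) + (X1 N i' - X1 N i) * X2 N i by ring.
have -> : eps = B * (eps / (2 * B)) + (eps / (2 * B)) * B.
  by field; rewrite gt_eqF.
apply: (le_trans (ler_normD _ _)); rewrite !normrM; apply: lerD; apply: ler_pM => //.
- by rewrite (le_trans (H1 N i' iT))// !le_max lexx orbT.
- exact: Hd2.
- exact: Hd1.
- by rewrite (le_trans (H2 N i iT'))// !le_max lexx !orbT.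
Qed.

Lemma family_limM X1 X2 t : bounded_family X1 -> bounded_family X2 ->
  family_lim (fun N i => X1 N i * X2 N i) t = family_lim X1 t * family_lim X2 t.
Proof. by move=> b1 b2; apply: family_limE; apply: cvgM; exact: family_cvg. Qed.

Lemma eventually_family_limE X Y t (M : nat) :
  (forall N i, (M <= N)%N -> X N i = Y N i) -> family_lim X t = family_lim Y t.
Proof.
move=> XY; rewrite /family_lim; congr (lim _); apply/seteqP.
have UM : U [set N | (M <= N)%N] by apply: U_oo; exact: nbhs_infty_ge.
split=> A /= UA; apply: filterS (filterI UM UA) => N [/= MN];
  by rewrite /family_at XY.
Qed.

Lemma bounded_family_cst (x : R) : bounded_family (fun _ _ => x).
Proof. by move=> T; exists `|x|. Qed.

Lemma equicontinuous_family_cst (x : nat -> R) : equicontinuous_family (fun N _ => x N).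
Proof. by move=> T eps e0; exists 1 => // *; rewrite subrr normr0 ltW. Qed.

Lemma bounded_familyD X1 X2 : bounded_family X1 -> bounded_family X2 ->
  bounded_family (fun N i => X1 N i + X2 N i).
Proof.
move=> b1 b2 T; have [B1 H1] := b1 T; have [B2 H2] := b2 T.
by exists (B1 + B2) => N i iT; rewrite (le_trans (ler_normD _ _))// lerD ?H1 ?H2.
Qed.

Lemma equicontinuous_familyD X1 X2 : equicontinuous_family X1 -> equicontinuous_family X2 ->
  equicontinuous_family (fun N i => X1 N i + X2 N i).
Proof.
move=> e1 e2 T eps e0; have e20 : 0 < eps / 2 by rewrite divr_gt0.
have [d1 d10 Hd1] := e1 T _ e20; have [d2 d20 Hd2] := e2 T _ e20.
exists (Num.min d1 d2); first by rewrite lt_min d10.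
move=> N i i' ii' iT; rewrite le_min => /andP[id1 id2].
rewrite opprD addrACA (le_trans (ler_normD _ _))// (splitr eps).
by rewrite lerD ?Hd1 ?Hd2.
Qed.

Lemma bounded_familyN X : bounded_family X -> bounded_family (fun N i => - X N i).
Proof. by move=> b1 T; have [B H] := b1 T; exists B => N i iT; rewrite normrN H. Qed.

Lemma bounded_family_if X (p : pred nat) : bounded_family X ->
  bounded_family (fun N i => if p N then X N i else 0).
Proof.
move=> b1 T; have [B H] := b1 T; exists `|B| => N i iT; case: ifP => _.
  by rewrite (le_trans (H N i iT))// ler_norm.
by rewrite normr0.
Qed.

Lemma equicontinuous_family_if X (p : pred nat) : equicontinuous_family X ->
  equicontinuous_family (fun N i => if p N then X N i else 0).
Proof.
move=> e1 T eps e0; have [d d0 H] := e1 T eps e0; exists d => // N i i' *.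
by case: ifP => _; [exact: H|rewrite subrr normr0 ltW].
Qed.

(** A three-epsilon argument; the approximating family may depend on T and eps, as the partial sums
    of a rate do. *)
Lemma equicontinuous_family_approx X :
  (forall T eps : R, 0 < eps -> exists2 Y, equicontinuous_family Y &
    forall N i, i%:R * h N <= T -> `|X N i - Y N i| <= eps) ->
  equicontinuous_family X.
Proof.
move=> H T eps e0; have e30 : 0 < eps / 3 by rewrite divr_gt0.
have [Y eY XY] := H T _ e30; have [d d0 Hd] := eY T _ e30.
exists d => // N i i' ii' iT id.
have iT' : i%:R * h N <= T by apply: le_trans iT; rewrite ler_pM2r// ler_nat.
have := Hd N i i' ii' iT id; have := XY N i' iT; have := XY N i iT'.
rewrite !ler_norml; lra.
Qed.

End StepFunctionLimits.

(** * Passage to the limit *)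

Section PassageToTheLimit.
Context {R : realType} (U : set_system nat) {UU : UltraFilter U} (h : nat -> R).
Hypothesis U_oo : \oo `<=` U.
Hypothesis h_gt0 : forall N, 0 < h N.
Hypothesis h_cvg : h @ \oo --> 0.

Variables (K : nat -> nat -> R) (lam P rho : R) (b : nat -> R).
Variables (f0 : nat -> R) (u : nat -> nat -> nat -> R).
Hypothesis lam_ge1 : 1 <= lam.
Hypothesis K_ge0 : forall j k, 0 <= K j k.
Hypothesis K_sym : forall j k, K j k = K k j.
Hypothesis b_gt0 : forall j, 0 < b j.
Hypothesis K_growth : forall j k, K j k <= b j * (1 + k%:R `^ lam).
Hypothesis u0E : forall N, u N 0%N = truncate N f0.
Hypothesis uS : forall N i, u N i.+1 = euler_step K (h N) N (u N i).
Hypothesis u_ge0 : forall N i j, 0 <= u N i j.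
Hypothesis u_number : forall N i m, \sum_(j < m) u N i j <= P.
Hypothesis u_mass : forall N i m, \sum_(j < m) j%:R * u N i j <= rho.
Hypothesis u_moment : forall T, exists B, forall N i m, i%:R * h N <= T ->
  \sum_(j < m) j%:R `^ lam * u N i j <= B.
Hypothesis u_tail : forall T eps : R, 0 < eps -> exists n, forall N i m,
  i%:R * h N <= T -> \sum_(n <= j < m) j%:R `^ lam * u N i j <= eps.

Definition component (j N i : nat) : R := u N i j.
Definition rate_family (c : nat -> R) (N i : nat) : R := rate c N (u N i).
Definition summable_kernel (a : R) (c : nat -> R) :=
  forall k, 0 <= c k <= a * (1 + k%:R `^ lam).

Let bounded := bounded_family h.
Let equicontinuous := equicontinuous_family h.
Let flim := family_lim U h.

Lemma component_bounded j : bounded (component j).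
Proof.
move=> T; exists P => N i _; rewrite ger0_norm; last exact: u_ge0.
apply: le_trans (u_number N i j.+1); rewrite big_ord_recr/= lerDr.
by apply: sumr_ge0.
Qed.

Lemma rate_familyE c N i :
  rate_family c N i = \sum_(0 <= k < N.+1) c k * u N i k.
Proof. by rewrite big_mkord. Qed.

Lemma summable_kernel_ge0 a c k : summable_kernel a c -> 0 <= c k.
Proof. by move=> /(_ k)/andP[]. Qed.

Lemma rate_family_ge0 a c N i : summable_kernel a c -> 0 <= rate_family c N i.
Proof.
move=> ac; apply: sumr_ge0 => k _; rewrite mulr_ge0//.
exact: summable_kernel_ge0 ac.
Qed.

Lemma rate_bounded a c : 0 < a -> summable_kernel a c -> bounded (rate_family c).
Proof.
move=> a0 ac T; have [B HB] := u_moment T; exists (a * (P + B)) => N i iT.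
rewrite ger0_norm; last exact: rate_family_ge0 ac.
apply: (@le_trans _ _ (a * (\sum_(k < N.+1) u N i k
   + \sum_(k < N.+1) k%:R `^ lam * u N i k))).
  rewrite -big_split/= mulr_sumr; apply: ler_sum => k _.
  have /andP[_ ck] := ac k.
  by apply: (le_trans (ler_wpM2r (u_ge0 N i k) ck)); rewrite -mulrA mulrDl mul1r.
by rewrite ler_pM2l// lerD// HB.
Qed.

Lemma rate_tail a c : 0 < a -> summable_kernel a c ->
  forall T eps : R, 0 < eps -> exists n : nat, forall N i m m', (n <= m)%N ->
  i%:R * h N <= T -> \sum_(m <= k < m') c k * u N i k <= eps.
Proof.
move=> a0 ac T eps e0.
have e20 : 0 < eps / (2 * a) by rewrite divr_gt0// mulr_gt0.
(* Starting at n.+1 guarantees k >= 1, hence 1 + k^lam <= 2 k^lam; this is the 2 in the choice of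
   the tolerance. *)
have [n Hn] := u_tail T _ e20; exists n.+1 => N i m m' nm iT.
have [m'm|mm'] := leqP m' m; first by rewrite big_geq// ltW.
apply: (@le_trans _ _ (2 * a * \sum_(m <= k < m') k%:R `^ lam * u N i k)).
  rewrite mulr_sumr !big_nat; apply: ler_sum => k /andP[mk _].
  rewrite mulrA ler_wpM2r//; have /andP[_ ck] := ac k; apply: (le_trans ck).
  have k1 : 1 <= k%:R :> R by rewrite ler1n (leq_trans _ mk)// (leq_trans _ nm).
  have : 1 <= k%:R `^ lam by rewrite (le_trans k1)// le1r_powR.
  nra.
apply: (@le_trans _ _ (2 * a * \sum_(n <= k < m') k%:R `^ lam * u N i k)).
  apply: ler_wpM2l; first by rewrite mulr_ge0// ltW.
  rewrite [leRHS](big_cat_nat (ltnW nm) (ltnW mm'))/=.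
  by rewrite lerDr sumr_ge0// => k _; rewrite mulr_ge0// powR_ge0.
by rewrite mulrC -ler_pdivlMr ?mulr_gt0// Hn.
Qed.

Definition partial_rate (c : nat -> R) (n N i : nat) : R :=
  \sum_(k < n) (if (k <= N)%N then c k * u N i k else 0).

(** The difference is a tail of the series, small uniformly in N. When n exceeds N.+1 the test k <=
    N makes the partial rate equal to the whole rate. *)
Lemma rate_partial a c : 0 < a -> summable_kernel a c ->
  forall T eps : R, 0 < eps -> exists n0 : nat, forall n N i, (n0 <= n)%N ->
  i%:R * h N <= T -> `|rate_family c N i - partial_rate c n N i| <= eps.
Proof.
move=> a0 ac T eps e0; have [n0 Hn] := rate_tail a c a0 ac T eps e0.
exists n0 => n N i nn iT.
have [nN|Nn] := leqP n N.+1.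
  have -> : partial_rate c n N i = \sum_(0 <= k < n) c k * u N i k.
    rewrite big_mkord; apply: eq_bigr => k _.
    by rewrite -ltnS (leq_trans (ltn_ord k) nN).
  rewrite rate_familyE (big_cat_nat (leq0n n) nN)/= addrAC subrr add0r.
  rewrite ger0_norm; first exact: Hn.
  by apply: sumr_ge0 => k _; rewrite mulr_ge0//; exact: summable_kernel_ge0 ac.
have -> : partial_rate c n N i = rate_family c N i.
  rewrite rate_familyE /partial_rate -(big_mkord xpredT (fun k =>
    if (k <= N)%N then c k * u N i k else 0)).
  rewrite (big_cat_nat (leq0n _) (ltnW Nn))/= [X in _ + X](_ : _ = 0).
    by rewrite addr0 !big_nat; apply: eq_bigr => k /andP[_]; rewrite ltnS => ->.
  rewrite big_nat_cond big1// => k /andP[/andP[Nk _] _].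
  by rewrite leqNgt Nk.
by rewrite subrr normr0 ltW.
Qed.

Lemma import_kernel_summable j : summable_kernel (b j) (import_kernel K j).
Proof.
move=> k; rewrite import_kernel_ge0//=.
exact: le_trans (import_kernel_le K K_ge0 K_sym j k) (K_growth j k).
Qed.

Lemma kernel_summable j : summable_kernel (b j) (K j).
Proof. by move=> k; rewrite K_ge0 K_growth. Qed.

(** * Bounds and equicontinuity of the fluxes *)

Definition out_family (j N i : nat) : R := outflux K N (u N i) j.
Definition in_family (j N i : nat) : R := influx K N (u N i) j.
Definition net_family (j N i : nat) : R := net_flux K N (u N i) j.

Lemma out_bounded j : bounded (out_family j).
Proof.
apply: (bounded_family_if h (fun N i => component j N i * rate_family (K j) N i)
  (fun N => (0 < j <= N)%N)).
apply: bounded_familyM; first exact: component_bounded.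
exact: rate_bounded (b_gt0 j) (kernel_summable j).
Qed.

Lemma in_bounded j : bounded (in_family j).
Proof.
apply: (bounded_family_if h
  (fun N i => component j N i * rate_family (import_kernel K j) N i)
  (fun N => (j <= N)%N)).
apply: bounded_familyM; first exact: component_bounded.
exact: rate_bounded (b_gt0 j) (import_kernel_summable j).
Qed.

Lemma net_bounded j : bounded (net_family j).
Proof.
apply: (bounded_familyD h (fun N i => out_family j.+1 N i - out_family j N i
  - in_family j N i) (fun N i => if j is l.+1 then in_family l N i else 0)).
  apply: bounded_familyD h _ _ _ (bounded_familyN h _ (in_bounded j)).
  exact: bounded_familyD h _ _ (out_bounded j.+1) (bounded_familyN h _ (out_bounded j)).
case: j => [|j]; [exact: bounded_family_cst|exact: in_bounded].
Qed.

(** The scheme satisfies the integrated equation exactly, with a Riemann sum as integral.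
    Boundedness of the fluxes alone thus makes the components equicontinuous, which in turn gives
    equicontinuity of the fluxes. *)
Lemma component_riemann_sum j N i :
  component j N i = truncate N f0 j + riemann_sum h (net_family j) N i.
Proof.
rewrite /component /riemann_sum; elim: i => [|i IH].
  by rewrite big_ord0 mulr0 addr0 u0E.
rewrite uS /euler_step -/(net_family j N i) IH big_ord_recr/= [in RHS]mulrDr.
by rewrite addrA.
Qed.

Lemma component_equicontinuous j : equicontinuous (component j).
Proof.
move=> T eps e0.
have [d d0 H] := equicontinuous_familyD h _ _
  (equicontinuous_family_cst h (fun N => truncate N f0 j))
  (riemann_sum_equicontinuous h h_gt0 _ (net_bounded j)) T eps e0.
by exists d => // N i i' *; rewrite !component_riemann_sum; exact: H.
Qed.

Lemma partial_rate_equicontinuous c n : equicontinuous (partial_rate c n).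
Proof.
elim: n => [|n IH] T eps e0.
  by exists 1 => // *; rewrite /partial_rate !big_ord0 subrr normr0 ltW.
have H1 : equicontinuous (fun N i => if (n <= N)%N then c n * u N i n else 0).
  apply: (equicontinuous_family_if h _ (fun N => (n <= N)%N)).
  apply: (equicontinuous_familyM h h_gt0 (fun _ _ => c n) (component n)).
  - exact: bounded_family_cst.
  - exact: component_bounded.
  - exact: (equicontinuous_family_cst h (fun=> c n)).
  - exact: component_equicontinuous.
have [d d0 H] := equicontinuous_familyD h _ _ IH H1 T eps e0.
by exists d => // N i i' *; rewrite /partial_rate !big_ord_recr/=; exact: H.
Qed.

Lemma rate_equicontinuous a c : 0 < a -> summable_kernel a c ->
  equicontinuous (rate_family c).
Proof.
move=> a0 ac; apply: (equicontinuous_family_approx h h_gt0) => T eps e0.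
have [n Hn] := rate_partial a c a0 ac T eps e0.
exists (partial_rate c n); first exact: partial_rate_equicontinuous.
by move=> N i; exact: Hn.
Qed.

Lemma out_equicontinuous j : equicontinuous (out_family j).
Proof.
apply: (equicontinuous_family_if h
  (fun N i => component j N i * rate_family (K j) N i) (fun N => (0 < j <= N)%N)).
apply: equicontinuous_familyM => //.
- exact: component_bounded.
- exact: rate_bounded (b_gt0 j) (kernel_summable j).
- exact: component_equicontinuous.
- exact: rate_equicontinuous (b_gt0 j) (kernel_summable j).
Qed.

Lemma in_equicontinuous j : equicontinuous (in_family j).
Proof.
apply: (equicontinuous_family_if h
  (fun N i => component j N i * rate_family (import_kernel K j) N i)
  (fun N => (j <= N)%N)).
apply: equicontinuous_familyM => //.
- exact: component_bounded.
- exact: rate_bounded (b_gt0 j) (import_kernel_summable j).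
- exact: component_equicontinuous.
- exact: rate_equicontinuous (b_gt0 j) (import_kernel_summable j).
Qed.

(** * The limit and its equation *)

Definition limit_solution (t : R) (j : nat) : R := flim (component j) t.

Lemma limit_solution_ge0 t j : 0 <= limit_solution t j.
Proof.
apply: (cvgr_to_ge (family_cvg U h h_gt0 _ t (component_bounded j))).
by apply: (@filterE _ U) => N; exact: u_ge0.
Qed.

Lemma partial_sum_cvg (c : nat -> R) t n :
  (fun N => \sum_(k < n) c k * u N (step_index h N t) k) @ U -->
  \sum_(k < n) c k * limit_solution t k.
Proof.
elim: n => [|n IH].
  under eq_fun do rewrite big_ord0.
  by rewrite big_ord0; exact: cvg_cst.
under eq_fun do rewrite big_ord_recr/=.
rewrite big_ord_recr/=; apply: cvgD; first exact: IH.
apply: cvgMr; exact: (family_cvg U h h_gt0 (component n) t (component_bounded n)).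
Qed.

(** A form of Fatou's lemma: finite partial sums pass to the limit, and a bound common to all of
    them survives. *)
Lemma limit_sum_le (c : nat -> R) (B : R) t n :
  (forall N m, \sum_(k < m) c k * u N (step_index h N t) k <= B) ->
  \sum_(k < n) c k * limit_solution t k <= B.
Proof.
move=> H; apply: (cvgr_to_le (partial_sum_cvg c t n)).
by apply: (@filterE _ U) => N; exact: H.
Qed.

Lemma partial_rate_lim c n t :
  flim (partial_rate c n) t = \sum_(k < n) c k * limit_solution t k.
Proof.
rewrite -(family_limE U h (fun N i => \sum_(k < n) c k * u N i k) t _
  (partial_sum_cvg c t n)).
apply: (eventually_family_limE U h U_oo _ _ t n) => N i nN.
apply: eq_bigr => k _.
by rewrite (leq_trans (ltnW (ltn_ord k)) nN).
Qed.

Lemma partial_rate_bounded a c n : summable_kernel a c -> 0 < a ->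
  bounded (partial_rate c n).
Proof.
move=> ac a0 T; elim: n => [|n [B HB]].
  by exists 0 => N i _; rewrite /partial_rate big_ord0 normr0.
have [B' HB'] : exists B', forall N i, i%:R * h N <= T ->
    `|if (n <= N)%N then c n * u N i n else 0| <= B'.
  apply: (bounded_family_if h _ (fun N => (n <= N)%N)).
  by apply: bounded_familyM; [exact: bounded_family_cst|exact: component_bounded].
exists (B + B') => N i iT; rewrite /partial_rate big_ord_recr/=.
by rewrite (le_trans (ler_normD _ _))// lerD ?HB ?HB'.
Qed.

(** The series and the limit along U are exchanged: by [rate_partial] the remainders are small
    uniformly in N. *)
Lemma rate_limit_series a c t : 0 < a -> summable_kernel a c ->
  ((fun n => \sum_(k < n) c k * limit_solution t k) @ \oo --> flim (rate_family c) t).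
Proof.
move=> a0 ac; apply/cvgrPdist_le => eps e0.
have [n0 Hn] := rate_partial a c a0 ac (Num.max t 0) eps e0.
exists n0 => // n /= n0n; rewrite -partial_rate_lim.
have H : `|family_at h (rate_family c) t N - family_at h (partial_rate c n) t N|
    @[N --> U] --> `|flim (rate_family c) t - flim (partial_rate c n) t|.
  apply: cvg_norm; apply: cvgB; apply: family_cvg => //.
    exact: rate_bounded a0 ac.
  exact: partial_rate_bounded ac a0.
apply: (cvgr_to_le H); apply: (@filterE _ U) => N.
by apply: Hn => //; exact: step_index_le_max.
Qed.

Lemma out_rateE t j :
  out_rate K (limit_solution t) j = (flim (rate_family (K j)) t)%:E.
Proof.
apply: cvg_lim => //; apply: cvg_EFin; first by apply: nearW => n; rewrite sumEFin.
rewrite (_ : fine \o _ = fun n => \sum_(k < n) K j k * limit_solution t k).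
  exact: rate_limit_series (b_gt0 j) (kernel_summable j).
by apply/funext => n /=; rewrite sumEFin/= big_mkord.
Qed.

Lemma in_rateE t j :
  in_rate K (limit_solution t) j = (flim (rate_family (import_kernel K j)) t)%:E.
Proof.
apply: cvg_lim => //; apply: cvg_EFin; first by apply: nearW => n; rewrite sumEFin.
rewrite (_ : fine \o _ =
    fun n => \sum_(k < n) import_kernel K j k * limit_solution t k).
  exact: rate_limit_series (b_gt0 j) (import_kernel_summable j).
apply/funext => n /=; rewrite sumEFin/=.
case: n => [|n]; first by rewrite big_ord0 big_geq.
by rewrite big_add1 big_mkord big_ord_recl/= mul0r add0r.
Qed.

Lemma out_familyE t j : (0 < j)%N ->
  flim (out_family j) t = limit_solution t j * flim (rate_family (K j)) t.
Proof.
move=> j0; rewrite -(family_limM U h h_gt0)//.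
- apply: (eventually_family_limE U h U_oo _ _ t j) => N i jN.
  by rewrite /out_family /outflux j0 jN.
- exact: component_bounded.
- exact: rate_bounded (b_gt0 j) (kernel_summable j).
Qed.

Lemma in_familyE t j :
  flim (in_family j) t = limit_solution t j * flim (rate_family (import_kernel K j)) t.
Proof.
rewrite -(family_limM U h h_gt0)//.
- apply: (eventually_family_limE U h U_oo _ _ t j) => N i jN.
  by rewrite /in_family /influx jN.
- exact: component_bounded.
- exact: rate_bounded (b_gt0 j) (import_kernel_summable j).
Qed.

Lemma out_termE t j : 0 <= t -> (0 < j)%N ->
  out_term K limit_solution t j = (flim (riemann_sum h (out_family j)) t)%:E.
Proof.
move=> t0 j0; rewrite -(riemann_sum_lim_integral U h U_oo h_gt0 h_cvg)//.
- by apply: eq_integral => s _; rewrite out_rateE -EFinM -out_familyE.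
- exact: out_bounded.
- exact: out_equicontinuous.
Qed.

Lemma in_termE t j : 0 <= t ->
  in_term K limit_solution t j = (flim (riemann_sum h (in_family j)) t)%:E.
Proof.
move=> t0; rewrite -(riemann_sum_lim_integral U h U_oo h_gt0 h_cvg)//.
- by apply: eq_integral => s _; rewrite in_rateE -EFinM -in_familyE.
- exact: in_bounded.
- exact: in_equicontinuous.
Qed.

Lemma riemann_sum_cvg X t : bounded X ->
  family_at h (riemann_sum h X) t @ U --> flim (riemann_sum h X) t.
Proof. by move=> bX; apply: family_cvg => //; exact: riemann_sum_bounded. Qed.

Lemma net_lim t j : flim (riemann_sum h (net_family j)) t =
  flim (riemann_sum h (out_family j.+1)) t - flim (riemann_sum h (out_family j)) t
  - flim (riemann_sum h (in_family j)) t
  + (if j is i.+1 then flim (riemann_sum h (in_family i)) t else 0).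
Proof.
apply: family_limE.
rewrite (_ : family_at _ _ _ = fun N =>
  family_at h (riemann_sum h (out_family j.+1)) t N
  - family_at h (riemann_sum h (out_family j)) t N
  - family_at h (riemann_sum h (in_family j)) t N
  + (if j is i.+1 then family_at h (riemann_sum h (in_family i)) t N else 0)).
  apply: cvgD.
    apply: cvgB; last exact: riemann_sum_cvg (in_bounded j).
    by apply: cvgB; apply: riemann_sum_cvg; exact: out_bounded.
  case: j => [|j]; first exact: cvg_cst.
  exact: riemann_sum_cvg (in_bounded j).
apply/funext => N; rewrite /family_at /riemann_sum.
rewrite -!mulrBr -!sumrB; case: j => [|j].
  rewrite addr0; congr (_ * _); apply: eq_bigr => i _.
  by rewrite /net_family /net_flux addr0.
by rewrite -mulrDr -big_split.
Qed.

Lemma limit_solutionE t j :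
  limit_solution t j = f0 j + flim (riemann_sum h (net_family j)) t.
Proof.
rewrite /limit_solution.
rewrite [LHS](eventually_family_limE U h U_oo _ (fun N i => f0 j
  + riemann_sum h (net_family j) N i) t j); last first.
  by move=> N i jN; rewrite component_riemann_sum /truncate jN.
apply: family_limE; apply: cvgD; first exact: cvg_cst.
exact: riemann_sum_cvg (net_bounded j).
Qed.

Lemma limit_solution0 : limit_solution 0 = f0.
Proof.
by apply/funext => j; rewrite limit_solutionE /flim (riemann_sum_lim0 U h h_gt0) addr0.
Qed.

Lemma out_family0 t : flim (riemann_sum h (out_family 0)) t = 0.
Proof.
apply: family_limE; rewrite (_ : family_at _ _ _ = cst 0); first exact: cvg_cst.
by apply/funext => N; rewrite /family_at /riemann_sum big1 ?mulr0.
Qed.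

Lemma limit_equation t j : 0 <= t ->
  (limit_solution t j - limit_solution 0 j)%:E
  = edg_integrated_rhs K limit_solution t j.
Proof.
move=> t0; rewrite limit_solution0 limit_solutionE addrAC subrr add0r net_lim.
case: j => [|j] /=.
  by rewrite out_family0 subr0 addr0 out_termE// in_termE// EFinB.
by rewrite !out_termE// !in_termE// EFinD !EFinB.
Qed.

Lemma normY_limit_le r B t :
  (forall n, \sum_(k < n) k%:R `^ r * limit_solution t k <= B) ->
  (normY r (limit_solution t) <= B%:E)%E.
Proof.
move=> H; rewrite /normY; apply: lime_le.
  by apply: is_cvg_nneseries => n _ _; rewrite lee_fin mulr_ge0// powR_ge0.
apply: nearW => n; rewrite sumEFin lee_fin big_mkord.
apply: le_trans (H n); apply: ler_sum => k _.
by rewrite ger0_norm// limit_solution_ge0.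
Qed.

(** The mass bound involves no time horizon, which gives the uniform bound on [0, +oo) asked by
    [mild_bounded]; the moment of order lam is bounded only on bounded time intervals. *)
Lemma limit_normY1 t : (normY 1 (limit_solution t) <= rho%:E)%E.
Proof.
apply: normY_limit_le => n; under eq_bigr do rewrite powRr1//.
by apply: limit_sum_le => N m; exact: u_mass.
Qed.

Lemma limit_Yplus t : Yplus lam (limit_solution t).
Proof.
split; last by move=> j; exact: limit_solution_ge0.
have [B HB] := u_moment (Num.max t 0).
rewrite /Y/=; apply: (@le_lt_trans _ _ B%:E); last exact: ltry.
apply: normY_limit_le => n; apply: (limit_sum_le (fun k => k%:R `^ lam)) => N m.
by apply: HB; exact: step_index_le_max.
Qed.

Lemma limit_global_mild_solution : global_mild_solution K f0 limit_solution.
Proof.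
split.
- exact: ltry.
- exact: limit_solution0.
- move=> t _; split; last by move=> j; exact: limit_solution_ge0.
  by rewrite /Y/=; exact: le_lt_trans (limit_normY1 t) (ltry _).
- move=> j; apply: continuous_subspaceT; apply: family_lim_continuous => //.
    exact: component_bounded.
  exact: component_equicontinuous.
- apply: (@le_lt_trans _ _ rho%:E); last exact: ltry.
  by apply: ub_ereal_sup => _ [t _ <-]; exact: limit_normY1.
- move=> j t [t0 _]; under eq_integral do rewrite out_rateE.
  rewrite (riemann_sum_lim_integral U h U_oo h_gt0 h_cvg)//; first exact: ltry.
    exact: rate_bounded (b_gt0 j) (kernel_summable j).
  exact: rate_equicontinuous (b_gt0 j) (kernel_summable j).
- by move=> j t [t0 _]; exact: limit_equation.
Qed.

End PassageToTheLimit.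

(** * Choice of the step, and conclusion *)

Lemma Yplus_partial_sums {R : realType} (r : R) (f : nat -> R) : Yplus r f ->
  exists L : R, forall n, \sum_(j < n) j%:R `^ r * f j <= L.
Proof.
move=> [Yf f_ge0]; exists (fine (normY r f)) => n.
have t0 j : (0 <= (j%:R `^ r * `|f j|)%:E :> \bar R)%E.
  by rewrite lee_fin mulr_ge0// powR_ge0.
have fin : normY r f \is a fin_num.
  by rewrite ge0_fin_numE//; apply: nneseries_ge0 => *.
rewrite -lee_fin fineK//; apply: le_trans (nneseries_lim_ge n _); last first.
  by move=> *; exact: t0.
rewrite sumEFin lee_fin big_mkord; apply: ler_sum => j _.
by rewrite ger0_norm.
Qed.

Lemma edg_solution_of_dissipative_kernel {R : realType} (K : nat -> nat -> R)
    (lam A L rho : R) (b f0 : nat -> R) :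
  1 <= lam -> lam <= 2 -> 0 <= A ->
  (forall j k, 0 <= K j k) -> (forall j k, K j k = K k j) ->
  (forall j k, (0 < j)%N -> (0 < k)%N -> K j k * j%:R `^ lam <=
     A * (j%:R ^+ 2 * (j%:R `^ lam * k%:R + j%:R * k%:R `^ lam))) ->
  (forall j, 0 < b j) -> (forall j k, K j k <= b j * (1 + k%:R `^ lam)) ->
  (forall j, 0 <= f0 j) -> (forall n, \sum_(j < n) j%:R * f0 j <= rho) ->
  (forall n, \sum_(j < n) j%:R `^ lam * f0 j <= L) ->
  exists f, global_mild_solution K f0 f /\ forall t, Yplus lam (f t).
Proof.
move=> lam1 lam2 A0 K0 Ksym Kdiss b0 Kgrowth f0_ge0 f0_mass f0_moment.
(* The mass does not see the empty clusters, which are added separately; for j >= 1, f0 j <= j f0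
   j. *)
pose P := f0 0%N + rho.
have f0_number n : \sum_(j < n) f0 j <= P.
  have r0 : 0 <= rho by have := f0_mass 0%N; rewrite big_ord0.
  case: n => [|n]; first by rewrite big_ord0 addr_ge0.
  rewrite big_ord_recl lerD2l; apply: le_trans (f0_mass n.+1).
  rewrite big_ord_recl mul0r add0r; apply: ler_sum => j _.
  by rewrite ler_peMl// ler1n.
have P0 : 0 <= P by have := f0_number 0%N; rewrite big_ord0.
pose Kmax N := \sum_(j < N.+1) \sum_(k < N.+1) K j k.
have Kmax0 N : 0 <= Kmax N by rewrite sumr_ge0// => j _; rewrite sumr_ge0.
have Kmax_ub N j k : (j <= N)%N -> (k <= N)%N -> K j k <= Kmax N.
  move=> jN kN; rewrite /Kmax (bigD1 (Ordinal (jN : j < N.+1)%N))//=.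
  rewrite (bigD1 (Ordinal (kN : k < N.+1)%N))//= -addrA lerDl addr_ge0//.
    by rewrite sumr_ge0.
  by rewrite sumr_ge0// => i _; rewrite sumr_ge0.
(* The term N.+1 forces h N to 0, the other one gives the CFL condition. The crude bound [Kmax]
   affects only the step, on which no estimate depends. *)
pose h N : R := (N.+1%:R + 2 * (Kmax N * P))^-1.
have KP N : 0 <= 2 * (Kmax N * P) by rewrite !mulr_ge0.
have den0 N : 0 < N.+1%:R + 2 * (Kmax N * P) by rewrite ltr_wpDr// ltr0n.
have h0 N : 0 < h N by rewrite invr_gt0.
have h_cvg : h @ \oo --> 0.
  apply: (@squeeze_cvgr _ _ _ _ (cst 0) (@harmonic R)).
  - apply: nearW => N; rewrite (ltW (h0 N))/= lef_pV2 ?posrE ?ltr0n//.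
    by rewrite lerDl.
  - exact: cvg_cst.
  - exact: cvg_harmonic.
have hcfl N : cfl K P (h N) N.
  split; first exact: ltW.
  exists (Kmax N); split => // [j k|]; first exact: Kmax_ub.
  by rewrite mulrC ler_pdivrMr// mul1r lerDr.
have [U [UU U_oo]] := @ultraFilterLemma nat \oo _.
pose u N i := euler K (h N) N f0 i.
have u_ge0 N i j : 0 <= u N i j by exact: (euler_ge0 K K0 Ksym f0 P).
have usum (phi : nat -> R) N i m : (forall j, 0 <= phi j) ->
    \sum_(j < m) phi j * u N i j <= mom phi N (u N i).
  by move=> phi0; apply: (sum_le_mom K K0 Ksym f0 P).
have u_number N i m : \sum_(j < m) u N i j <= P.
  apply: le_trans (proj2 (euler_admissible K K0 Ksym f0 P f0_ge0 f0_number
    (h N) N i (hcfl N))).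
  by have := usum (fun=> 1) N i m (fun=> ler01); under eq_bigr do rewrite mul1r.
have u_moment T : exists B, forall N i m, i%:R * h N <= T ->
    \sum_(j < m) j%:R `^ lam * u N i j <= B.
  exists (3 * (L * expR (18 * A * rho * T))) => N i m iT.
  apply: le_trans (usum (fun j => j%:R `^ lam) N i m _) _ => [j|].
    exact: powR_ge0.
  exact: (euler_moment K K0 Ksym lam A lam1 lam2 A0 Kdiss f0 P).
have H : global_mild_solution K f0 (limit_solution U h u).
  apply: (limit_global_mild_solution U h U_oo h0 h_cvg K lam P rho b) => //.
    move=> N i m; apply: le_trans (usum (fun j => j%:R) N i m _) _ => //.
    exact: euler_mass.
  move=> T eps e0.
  (* [euler_tail] asks for a nonnegative horizon, whereas T is arbitrary here. *)
  have T0 : 0 <= Num.max T 0 by rewrite le_max lexx orbT.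
  have [n Hn] := euler_tail K K0 Ksym lam A lam1 lam2 A0 Kdiss f0 P rho L
    f0_ge0 f0_number f0_mass f0_moment _ _ T0 e0.
  exists n => N i m iT; apply: Hn; first exact: hcfl.
  by rewrite le_max iT.
exists (limit_solution U h u); split=> // t.
exact: (limit_Yplus U h h0 lam P u).
Qed.

Theorem theorem2p2 (R : realType) (K : nat -> nat -> R) (Cq mu nu : R)
    (f0 : nat -> R)
    (Cq_gt0 : 0 < Cq)
    (mu_bounds : 0 <= mu <= 2) (nu_bounds : 0 <= nu <= 2)
    (munu_le3 : mu + nu <= 3)
    (K_ge0 : forall j k : nat, 0 <= K j k)
    (K_sym : forall j k : nat, K j k = K k j)
    (K_bound : forall j k : nat,
      K j k <= Cq * (j%:R `^ mu * k%:R `^ nu + j%:R `^ nu * k%:R `^ mu))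
    (f0_Y1 : Yplus 1 f0)
    (f0_mass : (moment 1 f0 < +oo)%E) :
  (1 < Num.max mu nu -> Yplus (Num.max mu nu) f0 ->
    exists f : R -> nat -> R, global_mild_solution K f0 f /\
      forall t : R, 0 <= t -> Yplus (Num.max mu nu) (f t)) /\
  (Num.max mu nu <= 1 ->
    exists f : R -> nat -> R, global_mild_solution K f0 f /\
      forall t : R, 0 <= t -> Yplus 1 (f t)).
Proof.
have /andP[mu0 mu2] := mu_bounds; have /andP[nu0 nu2] := nu_bounds.
(* Both parts are one statement, with lam = max(mu, nu) in the first and lam = 1 in the second. *)
suff main lam : 1 <= lam -> lam <= 2 -> mu <= lam -> nu <= lam -> Yplus lam f0 ->
    exists f, global_mild_solution K f0 f /\ forall t, Yplus lam (f t).
  split=> [l1 f0l|l1].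
    have [|||||f [Hf Yf]] := main (Num.max mu nu).
    - exact: ltW.
    - by rewrite ge_max mu2.
    - by rewrite le_max lexx.
    - by rewrite le_max lexx orbT.
    - exact: f0l.
    by exists f; split.
  move: l1; rewrite ge_max => /andP[mu1 nu1].
  have [|||||f [Hf Yf]] := main 1 => //; first lra.
  by exists f; split.
move=> lam1 lam2 mul nul f0l.
have [rho Hrho] := Yplus_partial_sums 1 f0 f0_Y1.
have [L HL] := Yplus_partial_sums lam f0 f0l.
apply: (edg_solution_of_dissipative_kernel K lam (2 * Cq) L rho
  (fun j => 2 * Cq * (1 + j%:R `^ lam))) => //.
- by rewrite mulr_ge0// ltW.
- move=> j k j0 k0.
  have j1 : 1 <= j%:R :> R by rewrite ler1n.
  have k1 : 1 <= k%:R :> R by rewrite ler1n.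
  apply: le_trans (ler_wpM2r (powR_ge0 _ _) (K_bound j k)) _.
  have H1 := powR_monomial_le mu nu lam _ _ lam1 mu2 nul munu_le3 j1 k1.
  have numu : nu + mu <= 3 by rewrite addrC.
  have H2 := powR_monomial_le nu mu lam _ _ lam1 nu2 mul numu j1 k1.
  rewrite (mulrC 2 Cq) -[leLHS]mulrA mulrDl -[leRHS]mulrA ler_pM2l//.
  by rewrite [leRHS]mulr_natl mulr2n lerD.
- by move=> j; rewrite !mulr_gt0// ltr_pwDl// powR_ge0.
- move=> j k; apply: (le_trans (K_bound j k)).
  (* At i = 0 and r = 0 the left side is 0^0 = 1, which the summand 1 accounts for. *)
  have powR_le1D (i : nat) (r : R) : 0 <= r -> r <= lam -> i%:R `^ r <= 1 + i%:R `^ lam.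
    move=> r0 rl; case: i => [|i].
      by rewrite ler_wpDr ?powR_ge0//; have [->|/powR0 ->] := eqVneq r 0; rewrite ?powRr0.
    by rewrite ler_wpDl// ler_powR// ler1n.
  rewrite /= (mulrC 2 Cq) -!mulrA ler_pM2l// [leRHS]mulr_natl mulr2n.
  by apply: lerD; apply: ler_pM; rewrite ?powR_ge0 ?powR_le1D.
- by have [] := f0_Y1.
- by move=> n; have := Hrho n; under eq_bigr do rewrite powRr1//.
Qed.
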